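(* Consider the following weight vectors of degree $5(2^0-1)+18\cdot 2^0=18$: $$\overline\omega_{[1]}=(2,2,1,1),\quad \overline\omega_{[2]}=(2,2,3),\quad \overline\omega_{[3]}=(2,4,2),\quad \overline\omega_{[4]}=(4,1,1,1),\quad \overline\omega_{[5]}=(4,1,3),\quad \overline\omega_{[6]}=(4,3,2).$$ Then: (i) $((Q^{\otimes5})^{\overline\omega_{[k]}})^{GL_5}=0$ for $k\in\{1,2,3,5,6\}$. (ii) $((Q^{\otimes5})^{\overline\omega_{[4]}})^{GL_5}=\langle[\Re_4']_{\overline\omega_{[4]}}\rangle$ (the $\mathbb F_2$-span), where $$\begin{aligned}\Re_4'={}&x_1x_2x_3x_4x_5^{14}+x_1x_2x_3x_4^{14}x_5+x_1x_2x_3^{14}x_4x_5+x_1x_2^{3}x_3x_4x_5^{12}\\&+x_1x_2^{3}x_3x_4^{12}x_5+x_1x_2^{3}x_3^{12}x_4x_5+x_1^{3}x_2x_3x_4x_5^{12}+x_1^{3}x_2x_3x_4^{12}x_5\\&+x_1^{3}x_2x_3^{12}x_4x_5+x_1^{3}x_2^{5}x_3x_4x_5^{8}+x_1^{3}x_2^{5}x_3x_4^{8}x_5+x_1^{3}x_2^{5}x_3^{8}x_4x_5.\end{aligned}$$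
   Context: Let $\mathscr A$ be the mod 2 Steenrod algebra, $\overline{\mathscr A}$ its positive degree part, and $\mathcal P_m=\mathbb F_2[x_1,\dots,x_m]$ with $\deg x_i=1$, viewed as an $\mathscr A$-module via $Sq^0(x_i)=x_i$, $Sq^1(x_i)=x_i^2$, $Sq^j(x_i)=0$ for $j>1$, and the Cartan formula. The group $GL_m=GL(m,\mathbb F_2)$ acts on $\mathcal P_m$ by linear substitution of the variables, commuting with the action of $\mathscr A$. A weight vector is a sequence $\omega=(\omega_1,\omega_2,\dots)$ of non-negative integers with $\omega_t=0$ for $t\gg0$ (trailing zeros are omitted); its degree is $\deg\omega=\sum_{t\ge1}2^{t-1}\omega_t$. For a monomial $X=x_1^{u_1}\cdots x_m^{u_m}$, its weight vector $\omega(X)$ has $\omega_t(X)=\sum_{j}\alpha_{t-1}(u_j)$, where $\alpha_s(u)$ is the coefficient of $2^s$ in the binary expansion of $u$. Weight vectors are ordered left-lexicographically. Let $\mathcal P_m^{\le\omega}$ (resp. $\mathcal P_m^{<\omega}$) be the span of the monomials $X$ with $\deg X=\deg\omega$ and $\omega(X)\le\omega$ (resp. $\omega(X)<\omega$), and put $$(Q^{\otimes m})^\omega=\mathcal P_m^{\le\omega}/\big((\overline{\mathscr A}\mathcal P_m\cap\mathcal P_m^{\le\omega})+\mathcal P_m^{<\omega}\big).$$ The class in $(Q^{\otimes m})^\omega$ of $F\in\mathcal P_m^{\le\omega}$ is denoted $[F]_\omega$. It is known that the $GL_m$-action on $\mathcal P_m$ induces an $\mathbb F_2GL_m$-module structure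 on $(Q^{\otimes m})^\omega$; the superscript $GL_m$ denotes the subspace of invariants. (For $\deg \omega=n$ the space $(Q^{\otimes m})^\omega$ is also written $(Q_n^{\otimes m})^\omega$.) *)

(* Defs.v *)
From HB Require Import structures.
From mathcomp Require Import all_boot all_algebra.
From mathcomp.multinomials Require Import mpoly.
From mathcomp.classical Require Import boolp.

Set Implicit Arguments.
Unset Strict Implicit.
Unset Printing Implicit Defensive.

Import GRing.Theory.
Local Open Scope ring_scope.
Local Open Scope quotient_scope.

Section QuotientSpace.
Variables (K : fieldType) (V : lmodType K) (U : submodClosed V).

(* In this version of the library submodClosed does not inherit zmodClosed,
   which Quotient.quot needs. *)
Definition quotsp_sub : {pred V} := U.

Lemma quotsp_sub_closed : submod_closed quotsp_sub.
Proof. exact: submodClosedP. Qed.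
HB.instance Definition _ :=
  GRing.isSubmodClosed.Build K V quotsp_sub quotsp_sub_closed.

Definition quotsp := Quotient.quot quotsp_sub.
HB.instance Definition _ := Choice.on quotsp.
HB.instance Definition _ := EqQuotient.on quotsp.
HB.instance Definition _ := GRing.Zmodule.on quotsp.

Definition quotsp_class (x : V) : quotsp := \pi_quotsp x.

Lemma quotsp_classP x y : quotsp_class x = quotsp_class y <-> x - y \in U.
Proof.
rewrite -[x - y \in U]/(x - y \in quotsp_sub) Quotient.idealrBE.
by split=> [/eqP|/eqP].
Qed.

Lemma quotsp_class_repr (c : quotsp) : quotsp_class (repr c) = c.
Proof. exact: reprK. Qed.

Lemma quotsp_classB : {morph quotsp_class : x y / x - y}.
Proof. exact: raddfB. Qed.

Definition quotsp_scale (a : K) (c : quotsp) := quotsp_class (a *: repr c).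

Lemma quotsp_classZ a x : quotsp_class (a *: x) = quotsp_scale a (quotsp_class x).
Proof.
apply/quotsp_classP; rewrite -scalerBr rpredZ //.
by apply/quotsp_classP; rewrite quotsp_class_repr.
Qed.

Lemma quotsp_classD : {morph quotsp_class : x y / x + y}.
Proof. exact: raddfD. Qed.

Lemma quotsp_scaleA a b c :
  quotsp_scale a (quotsp_scale b c) = quotsp_scale (a * b) c.
Proof.
by rewrite -[c]quotsp_class_repr -!quotsp_classZ scalerA.
Qed.

Lemma quotsp_scale1 : left_id 1 quotsp_scale.
Proof. by move=> c; rewrite -[c]quotsp_class_repr -!quotsp_classZ scale1r. Qed.

Lemma quotsp_scaleDr : right_distributive quotsp_scale +%R.
Proof.
move=> a c d; rewrite -[c]quotsp_class_repr -[d]quotsp_class_repr.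
by rewrite -quotsp_classD -!quotsp_classZ -quotsp_classD scalerDr.
Qed.

Lemma quotsp_scaleDl c : {morph quotsp_scale^~ c : a b / a + b}.
Proof.
move=> a b; rewrite -[c]quotsp_class_repr.
by rewrite -!quotsp_classZ -quotsp_classD scalerDl.
Qed.

HB.instance Definition _ := GRing.Zmodule_isLmodule.Build K quotsp
  quotsp_scaleA quotsp_scale1 quotsp_scaleDr quotsp_scaleDl.

HB.instance Definition _ := GRing.isZmodMorphism.Build V quotsp quotsp_class
  quotsp_classB.
HB.instance Definition _ := GRing.isScalable.Build K V quotsp *:%R quotsp_class
  quotsp_classZ.

End QuotientSpace.

Notation Pol m := {mpoly 'F_2[m]}.

Section Steenrod.
Variable m : nat.
Implicit Types f g : Pol m.

(* The total square, with values in Pol m [t]: the ring morphism sending x_i to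
   x_i + x_i^2 t. Its coefficient at t^k is Sq^k; multiplicativity is the
   Cartan formula (SqM). *)
Definition Sq_total : Pol m -> {poly Pol m} :=
  mmap (@polyC (Pol m) \o @mpolyC m 'F_2)
       (fun i : 'I_m => ('X_i)%:P + ('X_i ^+ 2)%:P * 'X).

Definition Sq (k : nat) f : Pol m := (Sq_total f)`_k.

HB.instance Definition _ := GRing.RMorphism.on Sq_total.

Lemma Sq_totalX i : Sq_total 'X_i = ('X_i)%:P + ('X_i ^+ 2)%:P * 'X.
Proof. by rewrite /Sq_total mmapX mmap1U. Qed.

Lemma Sq_totalC c : Sq_total c%:MP = (c%:MP)%:P.
Proof. by rewrite /Sq_total mmapC. Qed.

Lemma Sq_X k i :
  Sq k 'X_i = match k with 0 => 'X_i | 1 => 'X_i ^+ 2 | _ => 0 end.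
Proof.
rewrite /Sq Sq_totalX coefD coefCM coefX coefC.
by case: k => [|[|k]] /=; rewrite ?(mulr0, mulr1, addr0, add0r).
Qed.

Lemma Sq_1 k : Sq k 1 = (k == 0%N)%:R.
Proof. by rewrite /Sq rmorph1 coef1. Qed.

Lemma SqM k f g : Sq k (f * g) = \sum_(i < k.+1) Sq i f * Sq (k - i)%N g.
Proof. by rewrite /Sq rmorphM coefM. Qed.

Lemma SqB k : {morph Sq k : f g / f - g}.
Proof. by move=> f g; rewrite /Sq rmorphB coefB. Qed.

Lemma SqZ k c f : Sq k (c *: f) = c *: Sq k f.
Proof. by rewrite /Sq -!mul_mpolyC rmorphM /= Sq_totalC coefCM. Qed.

(* The action of Sq^{i_1} ... Sq^{i_r} for I = [:: i_1; ...; i_r], an element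
   of degree i_1 + ... + i_r of the Steenrod algebra. *)
Definition Sq_word (I : seq nat) f : Pol m := foldr Sq f I.

(* The positive degree part of the Steenrod algebra is spanned by the words in
   the Sq^i of positive degree. *)
Definition hit : {pred Pol m} := fun f =>
  `[< exists2 s : seq (seq nat * Pol m), all (fun If => 0 < sumn If.1)%N s
        & f = \sum_(If <- s) Sq_word If.1 If.2 >].

End Steenrod.
Arguments hit : clear implicits.

Section Weights.

(* Weight vectors are represented by lists; two lists that differ by trailing
   zeros stand for the same weight vector, and omega_t is nth 0 w t.-1. *)
Definition wdeg (w : seq nat) : nat := (\sum_(t < size w) 2 ^ t * nth 0 w t)%N.

(* Left lexicographic order, both lists being padded with zeros. *)
Fixpoint wle (w w' : seq nat) : bool :=
  match w, w' with
  | [::], _ => true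
  | a :: v, [::] => (a == 0)%N && wle v [::]
  | a :: v, b :: v' => (a < b)%N || (a == b)%N && wle v v'
  end.

Definition wlt (w w' : seq nat) : bool := ~~ wle w' w.

(* Exponents of u are at most mdeg u < 2 ^ mdeg u, so that no nonzero digit is
   lost: see nth_weight. *)
Definition weight m (u : 'X_{1..m}) : seq nat :=
  mkseq (fun t => \sum_(j < m) odd (u j %/ 2 ^ t))%N (mdeg u).

Lemma nth_weight m (u : 'X_{1..m}) t :
  nth 0%N (weight u) t = (\sum_(j < m) odd (u j %/ 2 ^ t))%N.
Proof.
have [lt_t|le_t] := ltnP t (mdeg u); first by rewrite nth_mkseq.
rewrite nth_default ?size_mkseq // big1 // => j _.
rewrite divn_small //; apply: leq_ltn_trans (ltn_expl t (ltnSn 1)).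
by apply: leq_trans le_t; rewrite mdegE (bigD1 j) //= leq_addr.
Qed.

Lemma wleP w w' :
  reflect (forall t, (forall i, i < t -> nth 0 w i = nth 0 w' i)%N ->
                     (nth 0 w t <= nth 0 w' t)%N)
          (wle w w').
Proof.
elim: w w' => [|a v IHv] [|b v'] /=.
- by apply: ReflectT => t _.
- by apply: ReflectT => t _; rewrite nth_nil.
- apply: (iffP andP) => [[/eqP-> /IHv vle] [|t] H //|H].
    rewrite nth_nil; have := vle t; rewrite nth_nil; apply=> i ltit.
    by rewrite nth_nil; have := H i.+1 ltit; rewrite nth_nil.
  have /eqP a0 : a == 0%N by rewrite -leqn0; exact: (H 0%N).
  split; first by rewrite a0.
  apply/IHv => t Ht; have := H t.+1; rewrite !nth_nil; apply=> -[|i] ltit.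
    by rewrite a0 nth_nil.
  by rewrite nth_nil; have := Ht i ltit; rewrite nth_nil.
apply: (iffP orP) => [[ltab [|t] H|/andP[/eqP-> /IHv vle] [|t] H]|H] //=.
- exact: ltnW.
- by have := H 0%N isT; rewrite /= => eqab; rewrite eqab ltnn in ltab.
- by apply: vle => i ltit; exact: (H i.+1).
have: (a <= b)%N by exact: (H 0%N).
rewrite leq_eqVlt => /orP[/eqP eqab|]; last by left.
right; rewrite eqab eqxx; apply/IHv => t Ht; apply: (H t.+1) => -[|i] //= ltit.
exact: Ht.
Qed.

Lemma wle_trans w2 w1 w3 : wle w1 w2 -> wle w2 w3 -> wle w1 w3.
Proof.
move=> /wleP H12 /wleP H23; apply/wleP => t Ht.
have H i : (i <= t)%N ->
    (forall j, j < i -> nth 0 w1 j = nth 0 w2 j)%N /\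
    (forall j, j < i -> nth 0 w2 j = nth 0 w3 j)%N.
  elim: i => [|i IHi] lti; first by [].
  have [E12 E23] := IHi (ltnW lti).
  have le12 := H12 i E12; have le23 := H23 i E23.
  have E13 := Ht i lti.
  have E : nth 0%N w1 i = nth 0%N w2 i.
    by apply/eqP; rewrite eqn_leq le12 E13 le23.
  have EE : nth 0%N w2 i = nth 0%N w3 i by rewrite -E.
  by split=> j; rewrite ltnS leq_eqVlt => /orP[/eqP-> //|];
    [exact: E12 | exact: E23].
have [E12 E23] := H t (leqnn t).
exact: leq_trans (H12 t E12) (H23 t E23).
Qed.

End Weights.

Section WeightFiltration.
Variables (m : nat) (w : seq nat).

Definition Pwle_pred : {pred Pol m} :=
  fun f => all (fun u => (mdeg u == wdeg w) && wle (weight u) w) (msupp f).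

Definition Pwlt_pred : {pred Pol m} :=
  fun f => all (fun u => (mdeg u == wdeg w) && wlt (weight u) w) (msupp f).

Lemma all_msupp_submod (a : pred 'X_{1..m}) :
  submod_closed (fun f : Pol m => all a (msupp f)).
Proof.
split=> [|c f g af ag]; first by rewrite unfold_in msupp0.
apply/allP => u /msuppD_le; rewrite mem_cat => /orP[/msuppZ_le|].
- by move/(allP af).
- by move/(allP ag).
Qed.

HB.instance Definition _ :=
  GRing.isSubmodClosed.Build _ _ Pwle_pred (all_msupp_submod _).
HB.instance Definition _ :=
  GRing.isSubmodClosed.Build _ _ Pwlt_pred (all_msupp_submod _).

Definition Pwle := {f : Pol m | f \in Pwle_pred}.
HB.instance Definition _ := SubChoice.on Pwle.
HB.instance Definition _ := [SubChoice_isSubLmodule of Pwle by <:].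

End WeightFiltration.
Arguments Pwle_pred : clear implicits.
Arguments Pwlt_pred : clear implicits.

Section GLAction.
Variable m : nat.
Implicit Types (f : Pol m) (u v : 'X_{1..m}) (g h : 'M['F_2]_m).

(* The substitution x_j |-> sum_i g_ij x_i, a left action (gl_actM). *)
Definition gl_act g f : Pol m := f \mPo [tuple \sum_i g i j *: 'X_i | j < m].

HB.instance Definition _ g := GRing.LRMorphism.copy (gl_act g)
  (comp_mpoly [tuple \sum_i g i j *: 'X_i | j < m]).

Lemma gl_actX g j : gl_act g 'X_j = \sum_i g i j *: 'X_i.
Proof. by rewrite /gl_act /comp_mpoly mmapX mmap1U tnth_mktuple. Qed.

Lemma gl_actC g c : gl_act g c%:MP = c%:MP.
Proof. exact: comp_mpolyC. Qed.

Lemma mpoly_rmorph_eq (R : comNzRingType) (phi psi : {rmorphism Pol m -> R}) :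
  (forall c, phi c%:MP = psi c%:MP) -> (forall i, phi 'X_i = psi 'X_i) ->
  phi =1 psi.
Proof.
move=> EC EX f; rewrite [f]mpolyE !rmorph_sum; apply: eq_bigr => u _ /=.
rewrite -mul_mpolyC !rmorphM /= EC mpolyXE_id !rmorph_prod; congr (_ * _).
by apply: eq_bigr => i _; rewrite !rmorphXn /= EX.
Qed.

Lemma gl_act1 f : gl_act 1%:M f = f.
Proof.
apply: (mpoly_rmorph_eq (phi := gl_act 1%:M) (psi := idfun)) => [c|j] /=.
  exact: gl_actC.
rewrite gl_actX (bigD1 j) //= mxE eqxx scale1r big1 ?addr0 // => i ij.
by rewrite mxE (negPf ij) scale0r.
Qed.

Lemma gl_actM g h f : gl_act (g *m h) f = gl_act g (gl_act h f).
Proof.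
apply: (mpoly_rmorph_eq (phi := gl_act (g *m h)) (psi := gl_act g \o gl_act h))
  => [c|j] /=; first by rewrite !gl_actC.
rewrite !gl_actX raddf_sum /=.
under [RHS]eq_bigr => k _ do rewrite linearZ /= gl_actX scaler_sumr.
rewrite exchange_big; apply: eq_bigr => i _.
rewrite mxE scaler_suml; apply: eq_bigr => k _.
by rewrite scalerA mulrC.
Qed.

Lemma pchar_P : 2 \in [pchar Pol m].
Proof. by rewrite pchar_lalg pchar_Fp. Qed.

Lemma sqr_F2 (a : 'F_2) : a ^+ 2 = a.
Proof. by case: a => [[|[|a]] lta]; apply/val_inj. Qed.

Lemma sqr_sum_P (I : Type) (r : seq I) (F : I -> Pol m) :
  (\sum_(i <- r) F i) ^+ 2 = \sum_(i <- r) F i ^+ 2.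
Proof. exact: (raddf_sum (pFrobenius_aut pchar_P)). Qed.

Lemma Sq_total_gl_act g f :
  Sq_total (gl_act g f) = map_poly (gl_act g) (Sq_total f).
Proof.
apply: (mpoly_rmorph_eq (phi := @Sq_total m \o gl_act g)
  (psi := map_poly (gl_act g) \o @Sq_total m)) => [c|j] /=.
  by rewrite gl_actC Sq_totalC map_polyC /= gl_actC.
rewrite Sq_totalX rmorphD rmorphM /= !map_polyC map_polyX /= rmorphXn /= gl_actX.
rewrite sqr_sum_P !rmorph_sum /= mulr_suml -big_split; apply: eq_bigr => i _ /=.
rewrite -!mul_mpolyC rmorphM /= Sq_totalC Sq_totalX.
rewrite exprMn -[in RHS]rmorphXn /= sqr_F2 !rmorphM /=.
by rewrite mulrDr !mulrA.
Qed.

Lemma Sq_gl_act g k f : Sq k (gl_act g f) = gl_act g (Sq k f).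
Proof. by rewrite /Sq Sq_total_gl_act coef_map. Qed.

Lemma hit_gl_act g f : f \in hit m -> gl_act g f \in hit m.
Proof.
move=> /asboolP[s s0 ->]; apply/asboolP.
exists [seq (If.1, gl_act g If.2) | If <- s]; first by rewrite all_map.
rewrite raddf_sum big_map; apply: eq_bigr => -[I f'] _ /=.
by elim: I => //= i I <-; rewrite Sq_gl_act.
Qed.

Lemma hit_submod_closed : submod_closed (hit m).
Proof.
have SqwordZ c I f : Sq_word I (c *: f) = c *: Sq_word I f.
  by elim: I => //= i I ->; rewrite SqZ.
split=> [|c f f' /asboolP[s s0 ->] /asboolP[s' s'0 ->]]; apply/asboolP.
  by exists [::]; rewrite ?big_nil.
exists ([seq (If.1, c *: If.2) | If <- s] ++ s').
  by rewrite all_cat s'0 all_map andbT.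
rewrite big_cat big_map scaler_sumr; congr (_ + _).
by apply: eq_bigr => If _; rewrite SqwordZ.
Qed.

HB.instance Definition _ :=
  GRing.isSubmodClosed.Build _ _ (hit m) hit_submod_closed.

Lemma msupp_gl_actX_mdeg g u v : v \in msupp (gl_act g 'X_[u]) -> mdeg v = mdeg u.
Proof.
suff /dhomogP H : gl_act g 'X_[u] \is (mdeg u).-homog by move/H.
rewrite mpolyXE_id rmorph_prod mdegE.
elim/big_rec2: _ => [|i d p _ homp]; first exact: dhomog1.
apply: dhomogM homp.
rewrite rmorphXn /= -[X in X.-homog]mul1n; apply: dhomogMn.
rewrite gl_actX; apply: rpred_sum => k _; apply: rpredZ.
by rewrite dhomogX; apply/eqP; exact: mdeg1.
Qed.

Lemma msupp_sqr f v :
  v \in msupp (f ^+ 2) -> exists2 v', v' \in msupp f & v = (v' + v')%MM.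
Proof.
rewrite {1}[f]mpolyE sqr_sum_P => /msupp_sum_le /flatten_mapP[v'].
rewrite filter_predT => v'f; rewrite exprZn ['X_[_] ^+ _]expr2 -mpolyXD => /msuppZ_le.
rewrite msuppX inE => /eqP->; exists v' => //.
Qed.

Definition mnm_odd u : 'X_{1..m} := [multinom (odd (u i) : nat) | i < m].
Definition mnm_half u : 'X_{1..m} := [multinom (u i)./2 | i < m].

Lemma mnm_odd_half u : u = (mnm_odd u + (mnm_half u + mnm_half u))%MM.
Proof.
by apply/mnmP => i; rewrite !mnmDE !mnmE addnn odd_double_half.
Qed.

Lemma wle_weight u v :
  (nth 0 (weight u) 0 <= nth 0 (weight v) 0)%N ->
  (nth 0 (weight u) 0 = nth 0 (weight v) 0 ->
   wle (weight (mnm_half u)) (weight (mnm_half v)))%N ->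
  wle (weight u) (weight v).
Proof.
have half z t : nth 0%N (weight z) t.+1 = nth 0%N (weight (mnm_half z)) t.
  rewrite !nth_weight; apply: eq_bigr => j _.
  by rewrite mnmE expnS divnMA divn2.
move=> le0 H; apply/wleP => -[//|t] Ht.
rewrite !half; have /wleP := H (Ht 0%N isT); apply => i lti.
by rewrite -!half; apply: Ht.
Qed.

Lemma weight0E u : nth 0%N (weight u) 0 = mdeg (mnm_odd u).
Proof.
by rewrite nth_weight mdegE; apply: eq_bigr => j _; rewrite mnmE divn1.
Qed.

Lemma msupp_gl_actX_wle g u v :
  v \in msupp (gl_act g 'X_[u]) -> wle (weight v) (weight u).
Proof.
have [n] := ubnP (mdeg u); elim: n => // n IHn in u v *; rewrite ltnS => ltn.
have [u0|u_gt0] := posnP (mdeg u).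
  have /eqP -> : u == 0%MM by rewrite -mdeg_eq0 u0.
  by rewrite mpolyX0 rmorph1 msupp1 inE => /eqP->; apply/wleP.
rewrite {1}[u]mnm_odd_half !mpolyXD !rmorphM /= -expr2.
case/msuppM_le/allpairsP => -[a b] /= [aE /msupp_sqr[b' bE ->] ->] {b}.
have le_odd k : (odd k <= k)%N by case: k => // k; case: odd.
have dega := msupp_gl_actX_mdeg aE.
have oddE : mnm_odd (a + (b' + b'))%MM = mnm_odd a.
  apply/mnmP => i; rewrite !mnmE; congr nat_of_bool.
  by rewrite addnn oddD odd_double addbF.
apply: wle_weight; rewrite !weight0E oddE -dega.
  by rewrite !mdegE; apply: leq_sum => i _; rewrite mnmE.
move=> odda.
have aodd i : (a i <= 1)%N.
  have /= := @leqif_sum _ predT (fun i => mnm_odd a i == a i) (mnm_odd a) a.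
  case=> [j _|_]; first by split=> //; rewrite mnmE.
  move: odda; rewrite !mdegE => ->; rewrite eqxx => /esym/forallP /(_ i) /eqP <-.
  by rewrite mnmE; case: odd.
have -> : mnm_half (a + (b' + b'))%MM = b'.
  apply/mnmP => i; rewrite !mnmE addnn halfD odd_double andbF doubleK.
  by case: (a i) (aodd i) => [|[]].
apply: IHn bE; apply: leq_trans ltn.
have E : mdeg u = (mdeg (mnm_odd u) + (mdeg (mnm_half u) + mdeg (mnm_half u)))%N.
  by rewrite {1}(mnm_odd_half u) !mdegD.
rewrite E; rewrite E in u_gt0.
case: (mdeg (mnm_half u)) u_gt0 => [|k _]; first by rewrite addn0.
by rewrite addnA -[ltnLHS]add0n ltn_add2r addnS.
Qed.
End GLAction.

Section WeightQuotient.
Variables (m : nat) (w : seq nat).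
Implicit Types (F : Pwle m w) (g : 'M['F_2]_m).

(* (hit /\ P^{<= w}) + P^{< w}, as a subspace of P^{<= w}. *)
Definition Qnull : {pred Pwle m w} := fun F =>
  `[< exists H K, [/\ H \in hit m, H \in Pwle_pred m w, K \in Pwlt_pred m w
                    & val F = H + K] >].

Lemma Qnull_closed : submod_closed Qnull.
Proof.
split=> [|c F F' /asboolP[H [K [hH lH lK FE]]] /asboolP[H' [K' [hH' lH' lK' FE']]]];
  apply/asboolP.
  by exists 0, 0; rewrite !rpred0 addr0.
exists (c *: H + H'), (c *: K + K'); split; rewrite ?rpredD ?rpredZ //.
by rewrite -[LHS]/(c *: val F + val F') FE FE' scalerDr addrACA.
Qed.

HB.instance Definition _ := GRing.isSubmodClosed.Build _ _ Qnull Qnull_closed.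

(* Qw is (Q^{(x) m})^w, and Qw_class F is [F]_w. *)
Definition Qw := quotsp Qnull.
HB.instance Definition _ := GRing.Lmodule.on Qw.

Definition Qw_class F : Qw := quotsp_class Qnull F.
HB.instance Definition _ := GRing.Linear.copy Qw_class (quotsp_class Qnull).

Lemma Qw_class_eq F F' : Qw_class F = Qw_class F' <-> F - F' \in Qnull.
Proof. exact: quotsp_classP. Qed.

Lemma Qw_class_surj (c : Qw) : exists F, c = Qw_class F.
Proof. by exists (repr c); rewrite /Qw_class quotsp_class_repr. Qed.

Lemma gl_act_all_msupp (a : pred 'X_{1..m}) g f :
  (forall u v, a u -> v \in msupp (gl_act g 'X_[u]) -> a v) ->
  all a (msupp f) -> all a (msupp (gl_act g f)).
Proof.
move=> aP /allP af; apply/allP => v.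
rewrite {1}[f]mpolyE raddf_sum => /msupp_sum_le /flatten_mapP[u].
rewrite filter_predT => /af au; rewrite /= linearZ => /msuppZ_le; exact: aP.
Qed.

Lemma Pwle_gl_act g f : f \in Pwle_pred m w -> gl_act g f \in Pwle_pred m w.
Proof.
apply: gl_act_all_msupp => u v /andP[/eqP <- uw] vu.
rewrite (msupp_gl_actX_mdeg vu) eqxx.
exact: wle_trans (msupp_gl_actX_wle vu) uw.
Qed.

Lemma Pwlt_gl_act g f : f \in Pwlt_pred m w -> gl_act g f \in Pwlt_pred m w.
Proof.
apply: gl_act_all_msupp => u v /andP[/eqP <- uw] vu.
rewrite (msupp_gl_actX_mdeg vu) eqxx; apply: contra uw => wv.
exact: wle_trans wv (msupp_gl_actX_wle vu).
Qed.

Definition Pwle_act g F : Pwle m w := Sub (gl_act g (val F)) (Pwle_gl_act g (valP F)).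

(* Independent of the choice of representative: see Qw_act_class. *)
Definition Qw_act g (c : Qw) : Qw := Qw_class (Pwle_act g (repr c)).

Lemma Qw_act_class g F : Qw_act g (Qw_class F) = Qw_class (Pwle_act g F).
Proof.
apply/quotsp_classP.
have /asboolP[H [K [hH lH lK E]]] : repr (Qw_class F) - F \in Qnull.
  by apply/quotsp_classP; exact: quotsp_class_repr.
apply/asboolP; exists (gl_act g H), (gl_act g K).
split; [exact: hit_gl_act|exact: Pwle_gl_act|exact: Pwlt_gl_act|].
by rewrite -raddfD -E !raddfB.
Qed.

Lemma Pwle_act_linear g : linear (Pwle_act g).
Proof.
move=> a F F'; apply/val_inj.
rewrite -[LHS]/(gl_act g (a *: val F + val F')).
by rewrite -[RHS]/(a *: gl_act g (val F) + gl_act g (val F')) linearP.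
Qed.

Lemma Qw_act_linear g : linear (Qw_act g).
Proof.
move=> a c d.
have [F ->] := Qw_class_surj c; have [F' ->] := Qw_class_surj d.
have <- := linearP Qw_class a F F'.
rewrite !Qw_act_class Pwle_act_linear.
exact: (linearP Qw_class).
Qed.

Lemma Qw_act1 c : Qw_act 1%:M c = c.
Proof.
have [F ->] := Qw_class_surj c; rewrite Qw_act_class; congr Qw_class.
by apply/val_inj; exact: gl_act1.
Qed.

Lemma Qw_actM g h c : Qw_act (g *m h) c = Qw_act g (Qw_act h c).
Proof.
have [F ->] := Qw_class_surj c; rewrite !Qw_act_class; congr Qw_class.
by apply/val_inj; exact: gl_actM.
Qed.

Definition Qw_inv : {pred Qw} := fun c =>
  `[< forall g, g \in unitmx -> Qw_act g c = c >].

Lemma Qw_inv_closed : submod_closed Qw_inv.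
Proof.
have act0 g : Qw_act g 0 = 0.
  by have := Qw_act_linear g (-1) 0 0; rewrite scaler0 addr0 scaleN1r addNr.
split=> [|a c d /asboolP Ic /asboolP Id]; apply/asboolP => g ug //.
by rewrite Qw_act_linear Ic ?Id.
Qed.

HB.instance Definition _ := GRing.isSubmodClosed.Build _ _ Qw_inv Qw_inv_closed.

End WeightQuotient.
Arguments Qnull : clear implicits.
Arguments Qw_inv : clear implicits.

Definition omega_bar (k : nat) : seq nat :=
  match k with
  | 1 => [:: 2; 2; 1; 1]
  | 2 => [:: 2; 2; 3]
  | 3 => [:: 2; 4; 2]
  | 4 => [:: 4; 1; 1; 1]
  | 5 => [:: 4; 1; 3]
  | 6 => [:: 4; 3; 2]
  | _ => [::]
  end%N.

Lemma omega_bar_deg k : (0 < k <= 6)%N -> wdeg (omega_bar k) = 18.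
Proof.
by case: k => [|[|[|[|[|[|[|k]]]]]]] // _; rewrite /wdeg !big_ord_recl big_ord0.
Qed.

Definition mon5 (a b c d e : nat) : Pol 5 := 'X_[ [multinom [tuple a; b; c; d; e]] ].

Definition Re4 : Pol 5 :=
  mon5 1 1 1 1 14 + mon5 1 1 1 14 1 + mon5 1 1 14 1 1 +
  mon5 1 3 1 1 12 + mon5 1 3 1 12 1 + mon5 1 3 12 1 1 +
  mon5 3 1 1 1 12 + mon5 3 1 1 12 1 + mon5 3 1 12 1 1 +
  mon5 3 5 1 1 8 + mon5 3 5 1 8 1 + mon5 3 5 8 1 1.

Lemma mon5_Pwle w a b c d e :
  let u := [:: a; b; c; d; e] in
  sumn u = wdeg w ->
  wle (mkseq (fun t => sumn [seq (odd (x %/ 2 ^ t) : nat) | x <- u]) (sumn u)) w ->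
  mon5 a b c d e \in Pwle_pred 5 w.
Proof.
move=> u du wu; rewrite unfold_in /Pwle_pred msuppX /= andbT.
set x := [multinom _].
have xE (f : nat -> nat) : (\sum_(j < 5) f (x j) = sumn [seq f y | y <- u])%N.
  by rewrite !big_ord_recl big_ord0 /u /= !multinomE !(tnth_nth 0%N).
have dx : mdeg x = sumn u by rewrite mdegE (xE id) map_id.
rewrite dx du eqxx /=; move: wu; rewrite /weight dx.
by congr (wle _ w); apply: eq_mkseq => t; rewrite (xE (fun y => odd (y %/ 2 ^ t))).
Qed.

Lemma Re4_Pwle : Re4 \in Pwle_pred 5 (omega_bar 4).
Proof.
have H a b c d e :
    let u := [:: a; b; c; d; e] in (sumn u == 18)%N &&
    wle (mkseq (fun t => sumn [seq (odd (x %/ 2 ^ t) : nat) | x <- u]) 18) (omega_bar 4) ->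
  mon5 a b c d e \in Pwle_pred 5 (omega_bar 4).
  by move=> u /andP[/eqP du wu]; apply: mon5_Pwle; rewrite du ?omega_bar_deg.
rewrite /Re4 !(rpredD, H) //.
Qed.

(* Main.v *)
(* Averaging an invariant class over the cyclic group of the five rotations of the
   variables does not change it, since 5 is odd. So modulo hits and smaller weights it
   is a combination of orbit sums of few monomials: peeling off hits
   [Sq (18 - deg v) (mon v)], each involving a single orbit not yet reduced, shows
   that these generate. Conversely, a linear functional that kills the hits and the
   monomials of smaller weight takes the same value on [g F] for all [g]; the simplest
   one is the coefficient of a spike such as x1^15 x2^3. Letting [g] run over products
   of a few transvections gives linear equations on the coefficients of the orbit sums
   whose only solution is 0, except for [omega_bar 4], where one orbit, congruent to
   [Re4], survives. The invariance of [Re4] is checked on transvections, which generate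
   GL_5(F_2). All data are explicit and the verification is by computation. *)
Require Import Defs.
From HB Require Import structures.
From Stdlib Require Import Ascii String.
From mathcomp Require Import all_boot all_algebra perm.
From mathcomp.multinomials Require Import mpoly.
From mathcomp.classical Require Import boolp.

Set Implicit Arguments.
Unset Strict Implicit.
Unset Printing Implicit Defensive.

Import GRing.Theory.
Local Open Scope ring_scope.

(** * Parity of multiplicities over F_2 *)

Lemma addF2 (V : lmodType 'F_2) (x : V) : x + x = 0.
Proof.
by rewrite -mulr2n -scaler_nat (_ : 2%:R = 0 :> 'F_2) ?scale0r //; apply/val_inj.
Qed.

Lemma even_sum_F2 (V : lmodType 'F_2) (I : eqType) (L : seq I) (A : I -> V) :
  {in L, forall x, ~~ odd (count_mem x L)} -> \sum_(x <- L) A x = 0.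
Proof.
move=> evenL; rewrite -big_undup_iterop_count big_seq big1 // => x.
rewrite mem_undup => /evenL /negPf evx; rewrite -[_ = 0]/(A x *+ count_mem x L = 0).
rewrite -[count_mem x L]odd_double_half evx add0n -mul2n.
by rewrite mulrnA mulr2n addF2 mul0rn.
Qed.

Lemma F2_cases (a : 'F_2) : a = 0 \/ a = 1.
Proof. by case: a => [[|[|a]] lta]; [left; apply/val_inj|right; apply/val_inj|]. Qed.

Lemma oppF2 (V : lmodType 'F_2) (x : V) : - x = x.
Proof. by apply/eqP; rewrite eq_sym -subr_eq0 opprK addF2. Qed.

(* Multisets over F_2: a trie stores the lists occurring an odd number of times. *)
Inductive trie := Trie of bool & seq trie.
Definition trie0 := Trie false [::].

Fixpoint trie_mem (k : seq nat) (t : trie) : bool :=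
  let: Trie b ch := t in if k is a :: k' then trie_mem k' (nth trie0 ch a) else b.

Fixpoint trie_toggle (k : seq nat) (t : trie) : trie :=
  let: Trie b ch := t in
  if k is a :: k' then Trie b (set_nth trie0 ch a (trie_toggle k' (nth trie0 ch a)))
  else Trie (~~ b) ch.

Lemma trie_mem0 k : trie_mem k trie0 = false.
Proof. by elim: k => //= a k; rewrite nth_nil. Qed.

Lemma trie_mem_toggle k k' t :
  trie_mem k (trie_toggle k' t) = (k == k') (+) trie_mem k t.
Proof.
elim: k' k t => [|a' k' IH] [|a k] [b ch] //=.
rewrite nth_set_nth /= eqseq_cons; case: eqP => [->|_] //=; exact: IH.
Qed.

Definition trie_of (L : seq (seq nat)) : trie := foldr trie_toggle trie0 L.

Lemma trie_mem_of k L : trie_mem k (trie_of L) = odd (count_mem k L).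
Proof.
elim: L => [|k' L IH] /=; first exact: trie_mem0.
by rewrite trie_mem_toggle IH oddD eq_sym; case: (_ == _).
Qed.

(** The trie is built once and queried on the members of [L] only; anything else has multiplicity
    0. *)
Definition all_even (L : seq (seq nat)) : bool :=
  let t := trie_of L in all (fun k => ~~ trie_mem k t) L.

Lemma all_evenP (L : seq (seq nat)) x : all_even L -> ~~ odd (count_mem x L).
Proof.
move=> /allP evenL; have [/evenL|] := boolP (x \in L).
  by rewrite trie_mem_of.
by move/count_memPn ->.
Qed.

Lemma all_even_sum (V : lmodType 'F_2) (L : seq (seq nat)) (A : seq nat -> V) :
  all_even L -> \sum_(x <- L) A x = 0.
Proof. by move=> evenL; apply: even_sum_F2 => x _; apply: all_evenP. Qed.

(** * Expansion of products of sums, and binomial coefficients mod 2 *)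

Fixpoint cart (ss : seq (seq nat)) : seq (seq nat) :=
  if ss is s :: ss' then [seq a :: r | a <- s, r <- cart ss'] else [:: [::]].

Lemma mem_cart ss r : (r \in cart ss) = all2 (fun a (s : seq nat) => a \in s) r ss.
Proof.
elim: ss r => [|s ss IH] [|a r] //=; first by apply/negbTE/negP => /allpairsP[[a r] [_ _]].
rewrite -IH; apply/allpairsP/andP => [[[a' r'] /= [? ? [-> ->]]] //|[? ?]].
by exists (a, r).
Qed.

Lemma size_cart ss r : r \in cart ss -> size r = size ss.
Proof. by rewrite mem_cart; elim: ss r => [|s ss IH] [|a r] //= /andP[_ /IH ->]. Qed.

Lemma uniq_cart ss : all uniq ss -> uniq (cart ss).
Proof.
elim: ss => //= s ss IH /andP[us /IH uc].
by apply: allpairs_uniq => // -[a r] [a' r'] _ _ /= [-> ->].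
Qed.

(** Distributivity, with the choices indexed by lists rather than by finite functions so that the
    expansion can be computed. *)
Lemma sum_cart (R : comNzRingType) (fs : seq (nat -> R)) ss :
  size fs = size ss ->
  \sum_(r <- cart ss) \prod_(p <- zip fs r) p.1 p.2 =
  \prod_(p <- zip fs ss) \sum_(a <- p.2) p.1 a.
Proof.
elim: fs ss => [|f fs IH] [|s ss] //=; first by rewrite big_nil big_seq1 big_nil.
case=> /IH {}IH; rewrite big_cons -IH big_allpairs_dep mulr_suml.
apply: eq_bigr => a _; rewrite mulr_sumr; apply: eq_bigr => r _.
by rewrite big_cons.
Qed.

(* The k with 'C(n, k) odd, by Lucas' theorem: n is read in base 2. *)
Fixpoint submasks_rec (d n : nat) : seq nat :=
  if d is d'.+1 then
    let s := map double (submasks_rec d' n./2) in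
    if odd n then s ++ map S s else s
  else [:: 0%N].
Definition submasks (n : nat) := submasks_rec n n.

(** By Frobenius (x + y)^n is (x^2 + y^2)^(n/2), times x + y when n is odd. The induction hypothesis
    is applied to x^2 and y^2, which doubles the indices; the extra factor contributes them once
    unchanged (from x) and once shifted by 1 (from y). *)
Lemma submasks_recP (R : comNzRingType) (x y : R) d n :
  2 \in [pchar R] -> (n <= d)%N ->
  all (fun k => k <= n)%N (submasks_rec d n) /\
  (x + y) ^+ n = \sum_(k <- submasks_rec d n) x ^+ (n - k) * y ^+ k.
Proof.
move=> ch2; elim: d n x y => [|d IH] n x y /=.
  by rewrite leqn0 => /eqP->; rewrite big_seq1 !expr0 mul1r.
move=> led; have led2 : (n./2 <= d)%N.
  by rewrite leq_half_double (leq_trans led) // ltnS -addnn leq_addr.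
have [/allP le2 E] := IH n./2 (x ^+ 2) (y ^+ 2) led2.
have {}E : ((x + y) ^+ 2) ^+ n./2 =
    \sum_(k <- map double (submasks_rec d n./2)) x ^+ (n./2.*2 - k) * y ^+ k.
  rewrite (_ : (x + y) ^+ 2 = x ^+ 2 + y ^+ 2); last first.
    exact: (rmorphD (pFrobenius_aut ch2)).
  by rewrite E big_map; apply: eq_bigr => k _; rewrite -!exprM -doubleB !mul2n.
have le3 : all (fun k => k <= n./2.*2)%N (map double (submasks_rec d n./2)).
  by rewrite all_map; apply/allP => k /le2 /=; rewrite leq_double.
have nE := odd_double_half n.
case: (boolP (odd n)) nE => /= [on|en] nE; last first.
  rewrite add0n in nE; rewrite nE in le3 E; split=> //.
  by rewrite -[in LHS]nE -mul2n exprM.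
split.
  apply/allP => k; rewrite mem_cat => /orP[/(allP le3) lek|/mapP[j /(allP le3) lej ->]].
    by rewrite -nE add1n; exact: leqW.
  by rewrite -nE add1n.
rewrite -[in LHS]nE exprD expr1 -mul2n exprM E big_cat [X in _ = _ + X]big_map /= mulrDl.
rewrite !mulr_sumr; congr (_ + _); rewrite !big_seq; apply: eq_bigr => k /(allP le3) lek.
  by rewrite -[in RHS]nE add1n subSn // exprS mulrA.
by rewrite -[in RHS]nE add1n subSS exprS mulrCA.
Qed.

Lemma uniq_submasks_rec d n : uniq (submasks_rec d n).
Proof.
elim: d n => //= d IH n.
have u2 : uniq (map double (submasks_rec d n./2)).
  by rewrite map_inj_uniq //; exact: double_inj.
case: odd => //; rewrite cat_uniq u2 map_inj_uniq ?u2 ?andbT //; last by move=> ? ? [].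
apply/hasPn => k /mapP[j /mapP[i _ ->] ->]; apply/negP => /mapP[i' _].
by move/(congr1 odd); rewrite /= !odd_double.
Qed.

Lemma submasks_le n k : k \in submasks n -> (k <= n)%N.
Proof.
(* The bound does not mention the ring, so any ring of characteristic 2 serves to instantiate the
   lemma. *)
by have [/allP le _] := submasks_recP (0 : Pol 1) 0 (pchar_P 1) (leqnn n); exact: le.
Qed.

Lemma exprD_submasks (R : comNzRingType) (x y : R) n : 2 \in [pchar R] ->
  (x + y) ^+ n = \sum_(k <- submasks n) x ^+ (n - k) * y ^+ k.
Proof. by move=> ch2; have [_ ->] := submasks_recP x y ch2 (leqnn n). Qed.

(** * Monomials and Steenrod squares *)

(** Exponent vectors are lists of length 5, on which the certificates compute. Under [ev] a list of
    them denotes a polynomial, with multiplicities read mod 2. *)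
Definition mnm (u : seq nat) : 'X_{1..5} := [multinom nth 0%N u i | i < 5].
Definition mon (u : seq nat) : Pol 5 := 'X_[mnm u].
Definition ev (L : seq (seq nat)) : Pol 5 := \sum_(u <- L) mon u.
Definition exps (m : 'X_{1..5}) : seq nat := [seq m i | i <- enum 'I_5].

Lemma size_exps m : size (exps m) = 5.
Proof. by rewrite size_map size_enum_ord. Qed.

Lemma expsK m : mnm (exps m) = m.
Proof.
apply/mnmP => i; rewrite mnmE (nth_map ord0) ?size_enum_ord //.
by rewrite nth_ord_enum.
Qed.

Lemma mon_exps m : mon (exps m) = 'X_[m].
Proof. by rewrite /mon expsK. Qed.

Lemma mnmK u : size u = 5 -> exps (mnm u) = u.
Proof.
move=> u5; apply: (@eq_from_nth _ 0%N); rewrite size_exps // => i lti.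
rewrite (nth_map ord0) ?size_enum_ord // mnmE.
by rewrite nth_enum_ord.
Qed.

Lemma seq5E u : size u = 5 -> [seq nth 0%N u (i : 'I_5) | i <- enum 'I_5] = u.
Proof. by move=> u5; rewrite -[RHS]mnmK //; apply: eq_map => i; rewrite mnmE. Qed.

Lemma mcoeff_mon u v : size u = 5 -> size v = 5 -> (mon u)@_(mnm v) = (u == v)%:R.
Proof.
move=> u5 v5; rewrite mcoeffX; congr (_%:R); congr nat_of_bool.
by apply/eqP/eqP => [/(congr1 exps)|->//]; rewrite !mnmK.
Qed.

Lemma mdeg_mnm u : size u = 5 -> mdeg (mnm u) = sumn u.
Proof.
move=> u5; rewrite mdegE; under eq_bigr do rewrite mnmE.
by rewrite sumnE (big_nth 0%N) u5 big_mkord.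
Qed.

Lemma monE u : mon u = \prod_(i < 5) 'X_i ^+ nth 0%N u i.
Proof. by rewrite /mon mpolyXE_id; apply: eq_bigr => i _; rewrite mnmE. Qed.

Lemma ev_cat L L' : ev (L ++ L') = ev L + ev L'.
Proof. exact: big_cat. Qed.

Lemma ev_flatten LL : ev (flatten LL) = \sum_(L <- LL) ev L.
Proof. by elim: LL => [|L LL IH]; rewrite ?big_nil ?big_cons -?IH -?ev_cat /ev ?big_nil. Qed.

(** The total square of x^a is x^a (1 + x t)^a, the sum of x^(a+k) t^k over the submasks k of a. The
    exponent of t is the increase in degree, so [sq_exps] finds Sq^i by filtering on the degree. *)
Definition sq_exps_all (v : seq nat) : seq (seq nat) :=
  cart [seq [seq (a + k)%N | k <- submasks a] | a <- v].
Definition sq_exps (i : nat) (v : seq nat) : seq (seq nat) :=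
  [seq u <- sq_exps_all v | sumn u == (sumn v + i)%N].

Lemma sq_exps_all_sum v u : u \in sq_exps_all v ->
  (sumn v + \sum_(p <- zip u v) (p.1 - p.2) = sumn u)%N.
Proof.
rewrite mem_cart; elim: v u => [|a v IH] [|b u] //=; first by rewrite big_nil.
case/andP=> /mapP[k _ ->] /IH <-; rewrite big_cons /= addKn.
by rewrite addnACA.
Qed.

Lemma Sq_mon i v : size v = 5 -> Sq i (mon v) = ev (sq_exps i v).
Proof.
move=> v5; rewrite /Sq monE rmorph_prod /=.
under eq_bigr => j _ do rewrite rmorphXn /= Sq_totalX.
have ch2 : 2 \in [pchar {poly Pol 5}] by rewrite pchar_poly pchar_P.
(* The term of the j-th factor in which x_j has exponent b carries t to the power b - v_j. *)
pose f (j : 'I_5) (b : nat) : {poly Pol 5} := ('X_j ^+ b)%:P * 'X^(b - nth 0%N v j).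
pose fs := [seq f j | j <- enum 'I_5].
have -> : \prod_(j < 5) (('X_j)%:P + ('X_j ^+ 2)%:P * 'X) ^+ nth 0%N v j =
    \sum_(r <- sq_exps_all v) \prod_(p <- zip fs r) p.1 p.2.
  rewrite sum_cart; last by rewrite /fs !size_map v5 -enumT size_enum_ord.
  rewrite -[in RHS](seq5E v5) -map_comp /fs zip_map.
  rewrite big_map big_enum /=.
  apply: eq_bigr => j _; rewrite exprD_submasks // big_map !big_seq.
  apply: eq_bigr => k /submasks_le lek.
  rewrite /f addKn -!polyC_exp exprMn -!polyC_exp mulrA -polyCM -exprM -exprD mul2n.
  by rewrite -addnn addnA subnK.
rewrite coef_sum /ev big_filter [RHS]big_mkcond /= !big_seq.
apply: eq_bigr => r rv; have := sq_exps_all_sum rv.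
have r5 : size r = 5 by rewrite (size_cart rv) size_map v5.
have zfs : zip fs r = [seq (f j, nth 0%N r j) | j <- enum 'I_5].
  by rewrite -[in LHS](seq5E r5) /fs zip_map.
have zrv : (\sum_(p <- zip r v) (p.1 - p.2) = \sum_(j < 5) (nth 0 r j - nth 0 v j))%N.
  by rewrite -[in LHS](seq5E r5) -[in LHS](seq5E v5) zip_map big_map big_enum.
rewrite zfs big_map big_enum /= zrv => <-.
rewrite eqn_add2l /f big_split /= -rmorph_prod /= -monE.
rewrite prodrXr coefCM coefXn eq_sym.
by case: (_ == _); rewrite ?mulr1 ?mulr0.
Qed.

(** Setting t = 0 in the total square is a ring morphism that fixes every variable. *)
Lemma Sq_0 m (f : Pol m) : Sq 0 f = f.
Proof.
rewrite /Sq -horner_coef0.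
apply: (mpoly_rmorph_eq (phi := horner_eval (0 : Pol m) \o @Sq_total m) (psi := idfun))
  => [c|i] /=; rewrite /horner_eval ?Sq_totalC ?Sq_totalX hornerE //.
by rewrite ?hornerE ?mulr0 ?addr0.
Qed.

Lemma mon_gl_act g u : gl_act g (mon u) = \prod_(l < 5) (gl_act g 'X_l) ^+ nth 0%N u l.
Proof. by rewrite monE rmorph_prod; apply: eq_bigr => l _; rewrite rmorphXn. Qed.

(* Acts by [x_i |-> x_i + x_j]; column [i] of the matrix is the image of [x_i]. *)
Definition transv m (i j : 'I_m) : 'M['F_2]_m := 1%:M + delta_mx j i.

Lemma transv_actX m (i j l : 'I_m) :
  gl_act (transv i j) 'X_l = 'X_l + (if l == i then 'X_j else 0).
Proof.
rewrite gl_actX; under eq_bigr => k _ do rewrite !mxE scalerDl.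
rewrite big_split /=; congr (_ + _).
  rewrite (bigD1 l) //= eqxx scale1r big1 ?addr0 // => k kl.
  by rewrite (negPf kl) scale0r.
case: (l == i); last by rewrite big1 // => k _; rewrite andbF scale0r.
rewrite (bigD1 j) //= eqxx scale1r big1 ?addr0 // => k kj.
by rewrite (negPf kj) scale0r.
Qed.

Lemma transv_unit m (i j : 'I_m) : i != j -> transv i j \in unitmx.
Proof.
move=> ij; have E : transv i j *m transv i j = 1%:M.
  rewrite mulmxDl !mul1mx mulmxDr mulmx1 mul_delta_mx_0 // addr0 -addrA.
  by rewrite addF2 addr0.
by case/mulmx1_unit: E.
Qed.

(** The terms of (x_i + x_j)^(u_i): the amount k moves from the exponent of x_i to that of x_j. *)
Definition transv_exps (i j : nat) (u : seq nat) : seq (seq nat) :=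
  [seq set_nth 0 (set_nth 0 u i (nth 0 u i - k)) j (nth 0 u j + k)
     | k <- submasks (nth 0 u i)]%N.

Lemma transv_mon (i j : 'I_5) u : i != j ->
  gl_act (transv i j) (mon u) = ev (transv_exps i j u).
Proof.
move=> ij; rewrite mon_gl_act (bigD1 i) //= transv_actX eqxx.
rewrite exprD_submasks ?pchar_P // mulr_suml /ev big_map; apply: eq_bigr => k _.
have nij : (i == j :> nat) = false by apply/negbTE; apply: contra ij => /eqP/val_inj->.
rewrite monE [RHS](bigD1 i) //= nth_set_nth /= nij nth_set_nth /= eqxx -mulrA; congr (_ * _).
have ji : j != i by rewrite eq_sym.
rewrite (bigD1 j) //= [RHS](bigD1 j) //= nth_set_nth /= eqxx mulrA.
rewrite transv_actX (negPf ji) addr0 -exprD addnC; congr (_ * _).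
apply: eq_bigr => l /andP[li lj].
have nlj : (l == j :> nat) = false by apply/negbTE; apply: contra lj => /eqP/val_inj->.
have nli : (l == i :> nat) = false by apply/negbTE; apply: contra li => /eqP/val_inj->.
by rewrite transv_actX (negPf li) addr0 nth_set_nth /= nlj nth_set_nth /= nli.
Qed.

Definition rot_mx : 'M['F_2]_5 := perm_mx (perm (@ordS_inj 5)).

Lemma rot_unit : rot_mx \in unitmx.
Proof. exact: unitmx_perm. Qed.

(** The substitution sends x_(i+1) to x_i cyclically, so the exponents shift one place to the
    left. *)
Lemma rot_mon u : size u = 5 -> gl_act rot_mx (mon u) = mon (rot 1 u).
Proof.
move=> u5; rewrite mon_gl_act monE (reindex (@ordS 5)) /=; last first.
  by apply: onW_bij; exists (@ord_pred 5); [exact: ordSK|exact: ord_predK].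
apply: eq_bigr => i _; rewrite gl_actX (bigD1 i) //= !mxE permE eqxx scale1r.
rewrite big1 ?addr0 => [|k ki]; last first.
  by rewrite !mxE permE (inj_eq (@ordS_inj 5)) (negPf ki) scale0r.
congr (_ ^+ _).
by case: u u5 => [|? [|? [|? [|? [|? []]]]]] // _; case: i => -[|[|[|[|[|]]]]].
Qed.

(** * Hits and smaller weights *)

Section HitLower.
Variable w : seq nat.

(** Vanishing in the quotient, stated for arbitrary polynomials. On P^{<= w} it agrees with [Qnull],
    since there H = f - K has weights at most w; see [Qnull_hit_lt]. *)
Definition hit_lt (f : Pol 5) : Prop :=
  exists H K, [/\ H \in hit 5, K \in Pwlt_pred 5 w & f = H + K].

Lemma hit_lt_hit f : f \in hit 5 -> hit_lt f.
Proof. by move=> hf; exists f, 0; rewrite rpred0 addr0. Qed.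

Lemma hit_lt_Pwlt f : f \in Pwlt_pred 5 w -> hit_lt f.
Proof. by move=> lf; exists 0, f; rewrite rpred0 add0r. Qed.

Lemma hit_lt0 : hit_lt 0. Proof. by apply: hit_lt_hit; rewrite rpred0. Qed.

Lemma hit_ltD f g : hit_lt f -> hit_lt g -> hit_lt (f + g).
Proof.
move=> [H [K [hH lK ->]]] [H' [K' [hH' lK' ->]]].
by exists (H + H'), (K + K'); rewrite !rpredD // addrACA.
Qed.

Lemma hit_ltZ a f : hit_lt f -> hit_lt (a *: f).
Proof.
move=> [H [K [hH lK ->]]].
by exists (a *: H), (a *: K); rewrite !rpredZ // scalerDr.
Qed.

Lemma hit_lt_sum (I : eqType) (r : seq I) (F : I -> Pol 5) :
  {in r, forall i, hit_lt (F i)} -> hit_lt (\sum_(i <- r) F i).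
Proof.
move=> rF; rewrite big_seq; elim/big_ind: _ => //; [exact: hit_lt0|exact: hit_ltD].
Qed.

Lemma hit_lt_gl_act g f : hit_lt f -> hit_lt (gl_act g f).
Proof.
move=> [H [K [hH lK ->]]]; exists (gl_act g H), (gl_act g K).
by split; [exact: hit_gl_act|exact: Pwlt_gl_act|exact: raddfD].
Qed.

Lemma Sq_hit i (f : Pol 5) : (0 < i)%N -> Sq i f \in hit 5.
Proof.
move=> i0; apply/asboolP; exists [:: ([:: i], f)]; first by rewrite /= addn0 i0.
by rewrite big_seq1.
Qed.

(** A computable form of the first n entries of [weight]: count the odd exponents, halve, repeat. *)
Fixpoint wt (n : nat) (u : seq nat) : seq nat :=
  if n is n'.+1 then sumn (map (nat_of_bool \o odd) u) :: wt n' (map half u) else [::].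

Lemma nth_wt n u t : size u = 5 -> (t < n)%N ->
  nth 0%N (wt n u) t = nth 0%N (weight (mnm u)) t.
Proof.
move=> u5 ltt; rewrite nth_weight.
have -> : (\sum_(j < 5) odd (mnm u j %/ 2 ^ t))%N
    = sumn [seq (odd (x %/ 2 ^ t) : nat) | x <- u].
  by rewrite sumnE big_map (big_nth 0%N) u5 big_mkord; apply: eq_bigr => j _; rewrite mnmE.
elim: n t u ltt {u5} => [|n IH] [|t] u //= ltt.
  by congr sumn; apply: eq_map => x; rewrite /= divn1.
rewrite IH // -map_comp; congr sumn; apply: eq_map => x.
by rewrite /= -divn2 -divnMA expnS.
Qed.

Definition low (u : seq nat) : bool := ~~ wle w (wt (size w) u).

(** [wle w] reads only the first [size w] entries of its second argument, so the truncated weight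
    decides the comparison. *)
Lemma lowE u : size u = 5 -> low u = wlt (weight (mnm u)) w.
Proof.
move=> u5; rewrite /low /wlt; congr (~~ _).
have : forall t, (t < size w)%N ->
    nth 0%N (wt (size w) u) t = nth 0%N (weight (mnm u)) t.
  by move=> t; exact: nth_wt.
move: (wt _ _) (weight _); elim: w => [|a v IH] //= x y xy.
have := xy 0%N isT.
case: x y xy => [|b x] [|c y] xy //= E.
- rewrite -E ltn0 /=; congr (_ && _).
  by apply: IH => t ltt; have /= := xy t.+1 ltt; rewrite !nth_nil.
- rewrite E ltn0 /=; congr (_ && _).
  by apply: IH => t ltt; have /= := xy t.+1 ltt; rewrite !nth_nil.
- by rewrite E; congr (_ || _ && _); apply: IH => t ltt; have := xy t.+1 ltt.
Qed.

Hypothesis w18 : wdeg w = 18%N.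

Lemma hit_lt_low u : size u = 5 -> sumn u = 18%N -> low u -> hit_lt (mon u).
Proof.
move=> u5 u18 lu; apply: hit_lt_Pwlt.
by rewrite unfold_in /Pwlt_pred msuppX /= andbT mdeg_mnm // u18 w18 eqxx -lowE.
Qed.

Definition sq18 (v : seq nat) : seq (seq nat) := sq_exps (18 - sumn v) v.

Lemma sq18P v u : (sumn v < 18)%N -> size v = 5 -> u \in sq18 v -> size u = 5 /\ sumn u = 18%N.
Proof.
move=> v18 v5; rewrite mem_filter => /andP[/eqP-> uv].
by rewrite subnKC 1?ltnW // (size_cart uv) size_map.
Qed.

Lemma sq18_hit v : (sumn v < 18)%N -> size v = 5 -> ev (sq18 v) \in hit 5.
Proof. by move=> v18 v5; rewrite -Sq_mon // Sq_hit // subn_gt0. Qed.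

Definition below18 (v : seq nat) : bool := (sumn v < 18)%N && (size v == 5).

Lemma sq18s_hit vs : all below18 vs -> ev (flatten (map sq18 vs)) \in hit 5.
Proof.
move=> /allP vsP; rewrite ev_flatten big_map big_seq rpred_sum // => v /vsP.
by case/andP=> v18 /eqP v5; exact: sq18_hit.
Qed.

Lemma sq18sP vs u : all below18 vs -> u \in flatten (map sq18 vs) ->
  size u = 5 /\ sumn u = 18%N.
Proof.
move=> /allP vsP /flattenP[_ /mapP[v /vsP /andP[v18 /eqP v5] ->]].
exact: sq18P.
Qed.

Definition in18 (u : seq nat) : bool := (sumn u == 18%N) && (size u == 5).

(** Adding the squares of the monomials of [vs] to [L] must cancel everything that is not of smaller
    weight. *)
Definition hit_cert (L vs : seq (seq nat)) : bool :=
  [&& all in18 L, all below18 vs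
    & all_even [seq u <- L ++ flatten (map sq18 vs) | ~~ low u]].

Lemma hit_certP L vs : hit_cert L vs -> hit_lt (ev L).
Proof.
case/and3P=> /allP L18 vsP evenL.
(* The hits are added twice: one copy leaves only monomials of smaller weight, the other is itself a
   hit. *)
rewrite -[ev L]addr0 -(addF2 (ev (flatten (map sq18 vs)))) addrA -ev_cat.
apply: hit_ltD; last by apply: hit_lt_hit; exact: sq18s_hit.
rewrite /ev (bigID (fun u => ~~ low u)) /= -big_filter all_even_sum // add0r.
under eq_bigl do rewrite negbK.
rewrite -big_filter; apply: hit_lt_sum => u; rewrite mem_filter => /andP[lu].
rewrite mem_cat => /orP[/L18/andP[/eqP u18 /eqP u5]|/(sq18sP vsP)[u5 u18]];
  exact: hit_lt_low.
Qed.

End HitLower.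

(** * Functionals on the quotient *)

Lemma natF2 n : n%:R = (odd n)%:R :> 'F_2.
Proof.
by elim: n => //= n IH; rewrite mulrS IH; case: odd; apply/val_inj.
Qed.

Definition pairing (S : seq (seq nat)) (f : Pol 5) : 'F_2 := \sum_(u <- S) f@_(mnm u).

Lemma pairing_is_linear S : linear_for *%R (pairing S).
Proof.
move=> c f g; rewrite /pairing mulr_sumr -big_split; apply: eq_bigr => u _.
by rewrite mcoeffD mcoeffZ.
Qed.

HB.instance Definition _ S :=
  GRing.isLinear.Build 'F_2 (Pol 5) 'F_2 *%R (pairing S) (pairing_is_linear S).

Lemma pairingZ S c f : pairing S (c *: f) = c * pairing S f.
Proof. by have := pairing_is_linear S c f 0; rewrite raddf0 !addr0. Qed.

Definition all5 (L : seq (seq nat)) : bool := all (fun u => size u == 5) L.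

Lemma pairing_ev S L : all5 S -> all5 L ->
  pairing S (ev L) = \sum_(u <- S) (count_mem u L)%:R.
Proof.
move=> /allP S5 /allP L5; rewrite /pairing !big_seq; apply: eq_bigr => u /S5/eqP u5.
rewrite /ev raddf_sum /= -sum1_count natr_sum [RHS]big_mkcond !big_seq.
apply: eq_bigr => v /L5/eqP v5; rewrite mcoeff_mon //=.
by case: (v == u).
Qed.

(** The count is exchanged: one lookup for each member of [L] replaces a pass through [L] for each
    member of [S]. *)
Lemma pairing_trie S L : all5 S -> all5 L ->
  pairing S (ev L) = (odd (count (fun v => trie_mem v (trie_of S)) L))%:R.
Proof.
move=> S5 L5; rewrite pairing_ev // -natF2; elim: L {L5} => [|v L IH] /=.
  by rewrite big1_seq.
have vS : (trie_mem v (trie_of S))%:R = \sum_(u <- S) (u == v)%:R :> 'F_2.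
  rewrite trie_mem_of -natF2 -sum1_count natr_sum big_mkcond.
  by apply: eq_bigr => u _ /=; case: (u == v).
rewrite natrD -IH vS -big_split; apply: eq_bigr => u _ /=.
by rewrite natrD eq_sym.
Qed.

(** The transpose of the total square in one variable: the exponents a, necessarily at most b, whose
    total square contains x^b. *)
Definition sq_dual1 (b : nat) : seq nat :=
  [seq a <- iota 0 b.+1 | b \in [seq (a + k)%N | k <- submasks a]].
Definition sq_dual (u : seq nat) : seq (seq nat) := cart (map sq_dual1 u).

Lemma mem_sq_dual u v : (v \in sq_dual u) = (u \in sq_exps_all v).
Proof.
rewrite !mem_cart; elim: u v => [|b u IH] [|a v] //=; rewrite IH mem_filter.
congr (_ && _); apply: andb_idr => /mapP[k _ ->].
by rewrite mem_iota ltnS leq_addr.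
Qed.

Lemma uniq_sq_exps_all v : uniq (sq_exps_all v).
Proof.
apply: uniq_cart; rewrite all_map; apply/allP => a _ /=.
by rewrite map_inj_uniq ?uniq_submasks_rec //; exact: addnI.
Qed.

Lemma uniq_sq_dual u : uniq (sq_dual u).
Proof.
by apply: uniq_cart; rewrite all_map; apply/allP => b _; rewrite /= filter_uniq ?iota_uniq.
Qed.

(* Decides that [pairing S] kills the hits and [Pwlt]: [D] lists the [v] such that
   some [u] in [S] occurs in the total square of [mon v], with multiplicity. *)
Definition null_functional (w : seq nat) (S : seq (seq nat)) : bool :=
  all (fun u => in18 u && ~~ low w u) S &&
  let D := flatten (map sq_dual S) in
  let t := trie_of D in all (fun v => (sumn v == 18%N) || ~~ trie_mem v t) D.

(** By transposition, pairing [S] with Sq^i of [mon v] counts how often v occurs among the dual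
    lists of the members of [S], and this number was checked to be even. *)
Lemma null_functional_Sq w S i f :
  null_functional w S -> (0 < i)%N -> pairing S (Sq i f) = 0.
Proof.
case/andP=> /allP SP /allP DP i0.
have S5 : all5 S by apply/allP => u /SP /andP[/andP[]].
have Smon v : size v = 5 -> pairing S (Sq i (mon v)) = 0.
  move=> v5; rewrite Sq_mon // pairing_ev //; last first.
    apply/allP => u; rewrite mem_filter => /andP[_ uv].
    by rewrite (size_cart uv) size_map v5.
  have [vi|vi] := eqVneq (sumn v + i)%N 18%N; last first.
    rewrite big1_seq // => u /SP /andP[/andP[/eqP u18 _] _].
    by rewrite (count_memPn _) // mem_filter u18 eq_sym (negPf vi).
  (* A monomial occurs at most once in a total square and in its transpose, so both counts are
     membership tests and agree by duality. *)
  transitivity ((count_mem v (flatten (map sq_dual S)))%:R : 'F_2).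
    rewrite count_flatten -map_comp sumnE big_map natr_sum !big_seq.
    apply: eq_bigr => u /SP /andP[/andP[/eqP u18 _] _] /=.
    rewrite (count_uniq_mem _ (uniq_sq_dual u)) mem_sq_dual.
    by rewrite count_uniq_mem ?filter_uniq ?uniq_sq_exps_all // mem_filter u18 vi eqxx.
  have [/DP|/count_memPn-> //] := boolP (v \in flatten (map sq_dual S)).
  (* The check exempts v of degree 18, which comes from Sq^0; this is excluded here by i > 0. *)
  have /negPf-> : sumn v != 18%N by rewrite -vi -[X in X != _]addn0 eqn_add2l eq_sym -lt0n.
  by rewrite trie_mem_of natF2 /= => /negPf->.
rewrite [f]mpolyE /Sq !raddf_sum /= coef_sum raddf_sum big1 // => m _.
rewrite -[_`_i]/(Sq i _) SqZ /= pairingZ -[X in Sq i X]mon_exps Smon ?mulr0 //.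
exact: size_exps.
Qed.

Lemma null_functional_hit_lt w S f :
  null_functional w S -> hit_lt w f -> pairing S f = 0.
Proof.
move=> SP [H [K [/asboolP[s s0 ->] lK ->]]]; rewrite raddfD raddf_sum /=.
rewrite big1_seq ?add0r => [|[I g] /= Is]; last first.
  (* Leading letters [Sq 0] act as the identity, and the first positive letter is then outermost. *)
  have /= := allP s0 _ Is; elim: I {Is} => //= -[|i] I IH.
    by rewrite add0n Sq_0.
  by move=> _; apply: null_functional_Sq SP _.
(* No monomial of [S] has smaller weight, so none occurs in [K]. *)
rewrite /pairing big1_seq // => u /= uS; apply: memN_msupp_eq0; apply/negP => uK.
have /andP[/allP/(_ u uS) /andP[/andP[_ /eqP u5] /negP nlow] _] := SP.
by apply: nlow; rewrite lowE //; have /andP[] := allP lK _ uK.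
Qed.

(** * Products of transvections *)

Definition word_ok (wd : seq (nat * nat)) : bool :=
  all (fun ij => [&& ij.1 < 5, ij.2 < 5 & ij.1 != ij.2])%N wd.
Definition act_exps (L : seq (seq nat)) (wd : seq (nat * nat)) : seq (seq nat) :=
  foldl (fun L ij => flatten (map (transv_exps ij.1 ij.2) L)) L wd.

(** The letters of a word act from left to right, so the first transvection is the rightmost factor
    of the matrix. *)
Lemma act_expsP wd : word_ok wd ->
  exists2 g, g \in unitmx & forall L, gl_act g (ev L) = ev (act_exps L wd).
Proof.
elim: wd => [|[i j] wd IH] /=.
  by move=> _; exists 1%:M; [exact: unitmx1 | move=> L; exact: gl_act1].
case/andP=> /and3P[i5 j5 ij] /IH[g ug gE].
have ij' : inord i != inord j :> 'I_5 by rewrite -val_eqE /= !inordK.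
exists (g *m transv (inord i) (inord j)); first by rewrite unitmx_mul ug transv_unit.
move=> L; rewrite gl_actM -gE; congr gl_act.
rewrite ev_flatten big_map raddf_sum; apply: eq_bigr => u _.
by rewrite /= transv_mon // !inordK.
Qed.

Lemma all5_act L wd : word_ok wd -> all5 L -> all5 (act_exps L wd).
Proof.
elim: wd L => [|[i j] wd IH] L //= /andP[/and3P[i5 j5 _] wdP] /allP L5.
apply: IH => //; apply/allP => _ /flattenP[_ /mapP[u /L5/eqP u5 ->] /mapP[k _ ->]].
by rewrite !size_set_nth u5 (maxn_idPr i5) (maxn_idPr j5).
Qed.

(** * Averaging over the rotations of the variables *)

Definition rots (u : seq nat) : seq (seq nat) := traject (rot 1) u 5.
Definition Avg (f : Pol 5) : Pol 5 := \sum_(k < 5) iter k (gl_act rot_mx) f.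

Lemma all5_rots u : size u = 5 -> all5 (rots u).
Proof. by move=> u5; rewrite /all5 /= !size_rot u5. Qed.

Lemma Avg_is_linear : linear Avg.
Proof.
move=> c f g; rewrite /Avg scaler_sumr -big_split; apply: eq_bigr => k _ /=.
by elim: (k : nat) => //= n ->; rewrite linearP.
Qed.
HB.instance Definition _ := GRing.isLinear.Build 'F_2 (Pol 5) (Pol 5) *:%R Avg Avg_is_linear.

Lemma sum_traject (V : nmodType) (T : Type) (f : T -> T) (F : T -> V) x n :
  \sum_(y <- traject f x n) F y = \sum_(k < n) F (iter k f x).
Proof.
elim: n x => [|n IH] x; first by rewrite big_nil big_ord0.
rewrite big_cons big_ord_recl IH; congr (_ + _).
by apply: eq_bigr => k _; rewrite -iterSr.
Qed.

Lemma size_iter_rot1 (u : seq nat) k : size (iter k (rot 1) u) = size u.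
Proof. by elim: k => //= k; rewrite size_rot. Qed.

Lemma Avg_mon u : size u = 5 -> Avg (mon u) = ev (rots u).
Proof.
move=> u5; rewrite /ev sum_traject; apply: eq_bigr => k _.
elim: (k : nat) => //= n ->; rewrite rot_mon // size_iter_rot1 //.
Qed.

Lemma Avg_ev L : all5 L -> Avg (ev L) = \sum_(u <- L) ev (rots u).
Proof.
move=> /allP L5; rewrite raddf_sum !big_seq; apply: eq_bigr => u /L5/eqP u5.
exact: Avg_mon.
Qed.

Lemma iter_rot1_id (u : seq nat) : iter (size u) (rot 1) u = u.
Proof.
have E k : (k <= size u)%N -> iter k (rot 1) u = rot k u.
  elim: k => [|k IH] ltk; first by rewrite rot0.
  by rewrite iterS (IH (ltnW ltk)) (rotS ltk).
by rewrite E // rot_size.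
Qed.

Lemma rots_rot1 v : size v = 5 -> ev (rots (rot 1 v)) = ev (rots v).
Proof.
move=> v5; rewrite /ev /rots !sum_traject.
(* With [mon v] added, both sides become the sum over six consecutive rotations, of which the last
   is v again. *)
apply: (addIr (mon v)); transitivity (\sum_(j < 6) mon (iter j (rot 1) v)).
  rewrite [RHS]big_ord_recl addrC; congr (_ + _).
  by apply: eq_bigr => j _; rewrite -iterSr.
rewrite [LHS]big_ord_recr; congr (_ + _).
by rewrite -[in RHS](iter_rot1_id v) v5.
Qed.

Lemma rots_rots u r : size u = 5 -> r \in rots u -> ev (rots r) = ev (rots u).
Proof.
move=> u5 /trajectP[k _ ->]; elim: k => // k <-.
by rewrite [iter k.+1 _ _]/= rots_rot1 // size_iter_rot1.
Qed.

Lemma hit_lt_Avg w f : hit_lt w f -> hit_lt w (Avg f).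
Proof.
move=> hf; apply: hit_lt_sum => k _.
by elim: (k : nat) => //= n IH; exact: hit_lt_gl_act.
Qed.

(* The number of rotations is odd. *)
Lemma hit_lt_sub_Avg w f :
  (forall g, g \in unitmx -> hit_lt w (gl_act g f - f)) -> hit_lt w (f - Avg f).
Proof.
move=> invf.
have -> : f - Avg f = \sum_(k < 5) (iter k (gl_act rot_mx) f - f).
  have f5 : f *+ 5 = f.
    by rewrite (mulrnDr f 1 4) (mulrnA f 2 2) [_ *+ 2 *+ 2]mulr2n addF2 addr0.
  by rewrite sumrB sumr_const card_ord f5 !oppF2 addrC.
apply: hit_lt_sum => k _; elim: (k : nat) => [|n IH] /=.
  by rewrite subrr; exact: hit_lt0.
(* Telescoping: the rotation applied to the previous difference, plus the difference for a single
   rotation. *)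
have -> : gl_act rot_mx (iter n (gl_act rot_mx) f) - f =
    gl_act rot_mx (iter n (gl_act rot_mx) f - f) + (gl_act rot_mx f - f).
  by rewrite (raddfB (gl_act rot_mx)) subrKA.
by apply: hit_ltD; [exact: hit_lt_gl_act|exact/invf/rot_unit].
Qed.

(** * Reduction to few orbits *)

(** On lists of equal length [wle] is the lexicographic order, so this picks the least rotation, a
    normal form for orbits. The proof relies on it through [canon_rots]. *)
Fixpoint canon_of (u : seq nat) (rs : seq (seq nat)) : seq nat :=
  if rs is r :: rs' then let b := canon_of u rs' in if wle r b then r else b else u.
Definition canon (u : seq nat) : seq nat := canon_of u (rots u).

Lemma canon_rots u : canon u \in rots u.
Proof.
have H rs : canon_of u rs \in u :: rs.
  elim: rs => [|r rs] /=; first exact: mem_head.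
  case: (wle r _); first by rewrite !inE eqxx orbT.
  by rewrite !inE => /orP[->|->]; rewrite ?orbT.
by rewrite /canon; have := H (rots u); rewrite in_cons => /orP[/eqP->|//]; exact: mem_head.
Qed.

Section Reduction.
Variables (w : seq nat) (G : seq (seq nat)).
Hypotheses (w18 : wdeg w = 18%N) (G5 : all5 G).

Definition red (f : Pol 5) : Prop := exists a : nat -> 'F_2,
  hit_lt w (f - \sum_(i < size G) a i *: ev (rots (nth [::] G i))).

Lemma red_hit_lt f : hit_lt w f -> red f.
Proof.
move=> hf; exists (fun=> 0); rewrite big1 ?subr0 // => i _; exact: scale0r.
Qed.

Lemma redD f g : red f -> red g -> red (f + g).
Proof.
move=> [a ha] [b hb]; exists (fun i => a i + b i).
have -> : \sum_(i < size G) (a i + b i) *: ev (rots (nth [::] G i)) =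
    \sum_(i < size G) a i *: ev (rots (nth [::] G i)) +
    \sum_(i < size G) b i *: ev (rots (nth [::] G i)).
  by rewrite -big_split; apply: eq_bigr => i _; exact: scalerDl.
by rewrite opprD addrACA; exact: hit_ltD.
Qed.

Lemma redZ c f : red f -> red (c *: f).
Proof.
move=> [a ha]; exists (fun i => c * a i).
have -> : \sum_(i < size G) (c * a i) *: ev (rots (nth [::] G i)) =
    c *: \sum_(i < size G) a i *: ev (rots (nth [::] G i)).
  by rewrite scaler_sumr; apply: eq_bigr => i _; rewrite scalerA.
by rewrite -scalerBr; exact: hit_ltZ.
Qed.

Lemma red_sum (I : eqType) (r : seq I) (F : I -> Pol 5) :
  {in r, forall i, red (F i)} -> red (\sum_(i <- r) F i).
Proof.
move=> rF; rewrite big_seq; elim/big_ind: _ => //; last exact: redD.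
exact/red_hit_lt/hit_lt0.
Qed.

Lemma red_gen u : u \in G -> red (ev (rots u)).
Proof.
move=> uG; exists (fun i => (i == index u G)%:R).
have ltu : (index u G < size G)%N by rewrite index_mem.
rewrite (bigD1 (Ordinal ltu)) //= eqxx scale1r nth_index // big1 ?addr0 => [|i iu].
  by rewrite subrr; exact: hit_lt0.
by rewrite -val_eqE /= in iu; rewrite (negPf iu) scale0r.
Qed.

Definition reducible (t : trie) := forall u, trie_mem u t -> red (ev (rots u)).

(* From the hit [\sum_(v <- vs) Sq (18 - deg v) (mon v)], averaged over rotations,
   if it involves, modulo [Pwlt], a single orbit not yet known to be reducible. *)
Definition learn (t : trie) (vs : seq (seq nat)) : trie :=
  let h := flatten (map sq18 vs) in
  let rest := [seq c <- map canon [seq u <- h | ~~ low w u] | ~~ trie_mem c t] in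
  if [seq u <- rest | odd (count_mem u rest)] is p :: _ then
    if all below18 vs && all_even (p :: rest) then trie_toggle p t else t
  else t.

Lemma learnP t vs : reducible t -> reducible (learn t vs).
Proof.
move=> redt; rewrite /learn; set h := flatten _; set rest := filter _ (map _ _).
case: [seq u <- rest | _] => [//|p _].
case: ifP => // /andP[vsP evenp] u; rewrite trie_mem_toggle.
have [-> _|_] := eqVneq u p; last exact: redt.
have h5 : all5 h by apply/allP => v /(sq18sP vsP)[/eqP].
have hA : hit_lt w (\sum_(v <- h) ev (rots v)).
  by rewrite -Avg_ev //; apply/hit_lt_Avg/hit_lt_hit/sq18s_hit.
(* The averaged hit is added twice. One copy is disposed of as a hit; in the other, the smaller
   weights and the known orbits are split off before cancelling against p. *)
have -> : ev (rots p) = ev (rots p) + \sum_(v <- h) ev (rots v) + \sum_(v <- h) ev (rots v).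
  by rewrite -addrA addF2 addr0.
apply: redD; last exact: red_hit_lt.
rewrite (bigID (fun v => low w v)) /= addrCA.
apply: redD.
  rewrite -big_filter; apply: red_sum => v; rewrite mem_filter => /andP[lv].
  move=> /(sq18sP vsP)[v5 v18]; apply: red_hit_lt; rewrite -Avg_mon //.
  exact/hit_lt_Avg/hit_lt_low.
have -> : \sum_(v <- h | ~~ low w v) ev (rots v) =
    \sum_(c <- map canon [seq v <- h | ~~ low w v]) ev (rots c).
  rewrite big_map -[LHS]big_filter [LHS]big_seq [RHS]big_seq; apply: eq_bigr => v.
  rewrite mem_filter => /andP[_ /(allP h5)/eqP v5].
  by rewrite (rots_rots v5 (canon_rots v)).
rewrite (bigID (fun c => trie_mem c t)) /= addrCA; apply: redD.
  rewrite -big_filter; apply: red_sum => c; rewrite mem_filter => /andP[ct _].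
  exact: redt.
(* In what remains p is the only orbit of odd multiplicity, so prepending p makes every multiplicity
   even and the sum zero. *)
rewrite -big_filter -/rest.
have := all_even_sum (fun c => ev (rots c)) evenp; rewrite big_cons => ->.
exact/red_hit_lt/hit_lt0.
Qed.

Definition saturate (rules : seq (seq (seq nat))) : trie := foldl learn (trie_of G) rules.

Lemma saturateP rules : reducible (saturate rules).
Proof.
rewrite /saturate; have : reducible (trie_of G).
  move=> u; rewrite trie_mem_of => /odd_gt0; rewrite -has_count has_pred1.
  exact: red_gen.
by elim: rules (trie_of G) => //= vs rules IH t redt; exact/IH/learnP.
Qed.

End Reduction.

(** * Monomials of a given weight *)

Definition bit_vectors (a : nat) : seq (seq nat) :=
  [seq b <- cart (nseq 5 [:: 0; 1]%N) | sumn b == a].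

(** One binary digit at a time: b holds the units digits of the five exponents and r their
    halves. *)
Fixpoint mons (w : seq nat) : seq (seq nat) :=
  if w is a :: w' then
    [seq [seq (p.1 + p.2.*2)%N | p <- zip b r]
       | b <- bit_vectors a, r <- mons w']
  else [:: nseq 5 0%N].

Lemma no_bits_eq0 n : (forall t, odd (n %/ 2 ^ t) = false) -> n = 0%N.
Proof.
elim/ltn_ind: n => -[//|n] IH nbits.
have n2 : (n.+1./2 = 0)%N.
  apply: IH => [|t]; first by rewrite -divn2 ltn_Pdiv.
  by rewrite -divn2 -divnMA -expnS nbits.
have := nbits 0%N; rewrite divn1 => odd0.
by rewrite -(odd_double_half n.+1) n2 odd0.
Qed.

Lemma mem_mons w u : size u = 5 ->
  (forall t, nth 0 w t = sumn [seq (odd (x %/ 2 ^ t) : nat) | x <- u])%N -> u \in mons w.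
Proof.
elim: w u => [|a w IH] u u5 wu.
  (* Beyond the end of w all digits are 0, so all exponents vanish. *)
  suff -> : u = nseq (size u) 0%N by rewrite u5 mem_head.
  apply/all_pred1P/allP => x xu; apply/eqP.
  apply: no_bits_eq0 => t; have := wu t; rewrite nth_nil => /esym/eqP.
  rewrite sumnE big_map sum_nat_seq_eq0 => /allP/(_ x xu) /=.
  by case: odd.
have uE : u = [seq (p.1 + p.2.*2)%N | p <- zip (map (nat_of_bool \o odd) u) (map half u)].
  rewrite zip_map -map_comp -[LHS]map_id; apply: eq_map => x /=.
  by rewrite odd_double_half.
rewrite [in X in X \in _]uE; apply: allpairs_f.
  rewrite mem_filter; apply/andP; split.
    have := wu 0%N => /= ->; apply/eqP; congr sumn; apply: eq_map => x.
    by rewrite /= divn1.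
  rewrite mem_cart; move: u5; clear; case: u => [|x1 [|x2 [|x3 [|x4 [|x5 []]]]]] //= _.
  by case: (odd x1); case: (odd x2); case: (odd x3); case: (odd x4); case: (odd x5).
apply: IH => [|t]; first by rewrite size_map.
rewrite -map_comp; have /= -> := wu t.+1; congr sumn; apply: eq_map => x /=.
by rewrite -divn2 -divnMA expnS.
Qed.

Definition covered (w : seq nat) (t : trie) : bool :=
  all (fun u => trie_mem (canon u) t) (mons w).

Lemma wle_anti w w' t : wle w w' -> wle w' w -> nth 0%N w t = nth 0%N w' t.
Proof.
move=> /wleP ww' /wleP w'w; elim/ltn_ind: t => t IH.
by apply/eqP; rewrite eqn_leq ww' // w'w // => i /IH.
Qed.

Lemma red_Avg w G t f : reducible w G t -> covered w t ->
  f \in Pwle_pred 5 w -> red w G (Avg f).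
Proof.
move=> redt /allP cov fw; rewrite [f]mpolyE raddf_sum; apply: red_sum => m mf /=.
rewrite linearZ /=; apply: redZ.
have /andP[m18 mw] := allP fw _ mf.
(* The weight either equals w, and then the orbit is covered, or is smaller. *)
have [wm|lm] := boolP (wle w (weight m)); last first.
  apply/red_hit_lt/hit_lt_Avg/hit_lt_Pwlt.
  by rewrite unfold_in /Pwlt_pred msuppX /= m18 /wlt lm.
rewrite -mon_exps Avg_mon ?size_exps // -(rots_rots (size_exps m) (canon_rots _)).
apply/redt/cov/mem_mons; first exact: size_exps.
move=> s; rewrite (wle_anti s wm mw) nth_weight sumnE big_map /exps big_map big_enum.
by [].
Qed.

(** * Certificates *)

Definition lincomb (n : nat) (rows : seq (seq bool)) : seq bool :=
  foldr (fun b acc => [seq p.1 (+) p.2 | p <- zip b acc]) (nseq n false) rows.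

Section LinearSystem.
Variables (n : nat) (x : nat -> 'F_2).

Definition dotp (b : seq bool) : 'F_2 := \sum_(i < n) (nth false b i)%:R * x i.

Lemma lincombP rows :
  {in rows, forall b, size b = n /\ dotp b = 0} ->
  size (lincomb n rows) = n /\ dotp (lincomb n rows) = 0.
Proof.
elim: rows => [|b rows IH] rowsP /=.
  rewrite size_nseq; split=> //; rewrite /dotp big1 // => i _.
  by rewrite nth_nseq if_same mul0r.
have [bn b0] := rowsP b (mem_head _ _).
have [|accn acc0] := IH; first by move=> r rr; apply: rowsP; rewrite inE rr orbT.
rewrite size_map size_zip bn accn minnn; split=> //.
rewrite -[RHS](addr0 0) -{1}b0 -acc0 /dotp -big_split; apply: eq_bigr => i _ /=.
rewrite (nth_map (false, false)) ?size_zip ?bn ?accn ?minnn // nth_zip ?bn ?accn //=.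
by rewrite -mulrDl; congr (_ * _); do 2!case: nth => //=; apply/val_inj.
Qed.

(** A combination of valid equations that equals the k-th unit vector reads x_k = 0. *)
Lemma lincomb_unit rows k : (k < n)%N ->
  {in rows, forall b, size b = n /\ dotp b = 0} ->
  lincomb n rows == mkseq (eq_op^~ k) n -> x k = 0.
Proof.
move=> ltk /lincombP[_ +] /eqP E; rewrite E /dotp (bigD1 (Ordinal ltk)) //=.
rewrite nth_mkseq // eqxx mul1r big1 ?addr0 // => i ik.
by rewrite nth_mkseq // -val_eqE /= in ik *; rewrite (negPf ik) mul0r.
Qed.

End LinearSystem.

Section Certificate.
Variables (w : seq nat) (free : nat) (G : seq (seq nat)) (S : seq (seq (seq nat))).
Variables (rules : seq (seq (seq nat))) (words : seq (nat * seq (nat * nat))).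
Variable mat : seq (seq bool).

(* The coefficients of an invariant [f], reduced to [\sum_i a_i *: ev (rots G_i)],
   satisfy [\sum_i a_i * pairing S_k (g (ev (rots G_i))) = pairing S_k f]. *)
Definition equation (tries : seq trie) (kw : nat * seq (nat * nat)) : seq bool :=
  let t := nth trie0 tries kw.1 in
  [seq odd (count (fun v => trie_mem v t) (act_exps (rots g) kw.2)) | g <- G]
    ++ mkseq (eq_op^~ kw.1) (size S).

Definition equations : seq (seq bool) := map (equation (map trie_of S)) words.

(** The unknowns are the coefficients of the orbit sums, followed by the values of the functionals
    on f. Row k of [mat] selects equations whose sum isolates unknown k; the first [free]
    coefficients stay undetermined. *)
Definition solved (eqs : seq (seq bool)) : bool :=
  all (fun k => lincomb (size G + size S) (mask (nth [::] mat k) eqs)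
                == mkseq (eq_op^~ k) (size G + size S))
      (iota free (size G - free)).

Definition certificate : bool :=
  [&& free <= size G, all5 G,
      all (fun kw => (kw.1 < size S) && word_ok kw.2) words,
      all (null_functional w) S, covered w (saturate w G rules)
    & solved equations]%N.

Lemma certificateP f : wdeg w = 18%N -> certificate -> f \in Pwle_pred 5 w ->
  (forall g, g \in unitmx -> hit_lt w (gl_act g f - f)) ->
  exists a : nat -> 'F_2,
    hit_lt w (f - \sum_(i < free) a i *: ev (rots (nth [::] G i))).
Proof.
move=> w18 /and5P[freeG G5 /allP wordsP /allP SP /andP[cov solv]] fw invf.
have [a ha] : red w G f.
  (* f - Avg f is null by invariance, and Avg f reduces to orbit sums of generators. *)
  rewrite -[f](subrK (Avg f)); apply: redD; first exact/red_hit_lt/hit_lt_sub_Avg.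
  by apply: red_Avg cov fw; exact: saturateP.
pose x i := if (i < size G)%N then a i else pairing (nth [::] S (i - size G)) f.
have eqsP : {in equations, forall b, size b = (size G + size S)%N /\
    dotp (size G + size S) x b = 0}.
  move=> _ /mapP[[k wd] /wordsP /= /andP[kS wdP] ->].
  rewrite size_cat size_map size_mkseq; split=> //.
  set th := nth [::] S k; have thP : null_functional w th by apply/SP/mem_nth.
  have th5 : all5 th by apply/allP => u uth; have /andP[/allP/(_ u uth)/andP[/andP[]]] := thP.
  have [g ug gE] := act_expsP wdP.
  pose h := \sum_(i < size G) a i *: ev (rots (nth [::] G i)).
  (* Both g (h - f) and g f - f are null, the latter by invariance, and the functional kills
     them. *)
  have E : pairing th (gl_act g h) = pairing th f.
    apply/eqP; rewrite -subr_eq0 -raddfB; apply/eqP/(null_functional_hit_lt thP).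
    have -> : gl_act g h - f = gl_act g (h - f) + (gl_act g f - f).
      by rewrite (raddfB (gl_act g)) subrKA.
    apply: hit_ltD; last exact: invf.
    by apply: hit_lt_gl_act; rewrite -opprB -scaleN1r; exact: hit_ltZ.
  rewrite /dotp big_split_ord /=.
  have -> : \sum_(i < size G) (nth false (equation (map trie_of S) (k, wd)) i)%:R * x i =
      pairing th (gl_act g h).
    rewrite /h (raddf_sum (gl_act g)) (raddf_sum (pairing th)) /=.
    apply: eq_bigr => i _; rewrite linearZ /= pairingZ gE mulrC.
    have r5 : all5 (rots (nth [::] G i)) by apply/all5_rots/eqP/(allP G5)/mem_nth.
    rewrite pairing_trie ?all5_act // /x ltn_ord nth_cat size_map ltn_ord.
    by rewrite (nth_map [::]) //= (nth_map [::]).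
  (* In the second block only unknown k has coefficient 1; it equals the first block and cancels it
     in characteristic 2. *)
  rewrite E (bigD1 (Ordinal kS)) //= big1 => [|i ik].
    rewrite nth_cat size_map ltnNge leq_addr /= addKn nth_mkseq // eqxx mul1r addr0.
    rewrite /x ltnNge leq_addr /= addKn -/th.
    by have [->|->] := F2_cases (pairing th f); rewrite ?addr0 //; apply/val_inj.
  rewrite nth_cat size_map ltnNge leq_addr /= addKn nth_mkseq //.
  by rewrite -val_eqE /= in ik; rewrite (negPf ik) mul0r.
have a0 i : (free <= i < size G)%N -> a i = 0.
  case/andP=> lei lti.
  have := @lincomb_unit (size G + size S) x (mask (nth [::] mat i) equations) i.
  rewrite /x lti; apply; first exact: ltn_addr.
    by move=> b /mem_mask; exact: eqsP.
  by apply: (allP solv); rewrite mem_iota lei subnKC.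
exists a; move: ha; congr (hit_lt _ (_ - _)).
rewrite (big_ord_widen _ (fun i => a i *: ev (rots (nth [::] G i))) freeG) [RHS]big_mkcond.
apply: eq_bigr => i _; case: ifP => // /negbT; rewrite -leqNgt => lei.
by rewrite a0 ?lei ?ltn_ord // scale0r.
Qed.

End Certificate.

(** * Decoding of the certificates *)

Definition digit (c : ascii) : option nat :=
  let n := nat_of_ascii c in
  (* 48 and 57 are the codes of 0 and 9; subtracting 87 sends the letter a to 10. *)
  if (n < 48)%N then None else Some (if (n < 58)%N then n - 48 else n - 87)%N.

(* The digits are 0-9a-z; any other character separates tokens. *)
Fixpoint tokens (s : string) : seq (seq nat) :=
  if s is String c s' then
    let ts := tokens s' in
    if digit c is Some d then (d :: head [::] ts) :: behead ts else [::] :: ts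
  else [:: [::]].

Definition fives (s : seq nat) : seq (seq nat) := reshape (nseq (size s %/ 5) 5) s.

Fixpoint pairs (s : seq nat) : seq (nat * nat) :=
  if s is i :: j :: s' then (i, j) :: pairs s' else [::].

(** [mask] drops whatever lies beyond its bits, so a row may stop at its last nonzero digit. *)
Definition nibbles (s : seq nat) : seq bool :=
  flatten [seq [:: odd d; odd d./2; odd d./2./2; odd d./2./2./2] | d <- s].

(* The fields list the generators, the functionals, the hits to learn from (each a
   concatenation of exponent vectors), the words (the index of a functional, then
   the pairs (i, j) of the transvections) and the rows of the matrix in hexadecimal,
   least significant digit first. They were found by Gaussian elimination. *)
Record cert_data := CertData {
  cert_gens : string;
  cert_functionals : seq string;
  cert_rules : string;
  cert_words : string;
  cert_matrix : string }.

Definition data_certificate (w : seq nat) (free : nat) (d : cert_data) : bool :=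
  certificate w free (tokens (cert_gens d)) (map tokens (cert_functionals d))
    (map fives (tokens (cert_rules d)))
    [seq (head 0%N s, pairs (behead s)) | s <- tokens (cert_words d)]
    (map nibbles (tokens (cert_matrix d))).

(** * Transvections generate GL_n over F_2 *)

Lemma mul_transv m (i j : 'I_m) (A : 'M['F_2]_m) k l :
  (transv i j *m A) k l = A k l + (if k == j then A i l else 0).
Proof.
rewrite mulmxDl mul1mx mxE; congr (_ + _); rewrite mxE.
rewrite (bigD1 i) //= big1 ?addr0 => [|h hi]; last first.
  by rewrite mxE (negPf hi) andbF mul0r.
by rewrite mxE eqxx andbT; case: eqP => _; rewrite ?mul1r ?mul0r.
Qed.

Section TransvectionsGenerate.
Variables (n : nat) (P : 'M['F_2]_n.+1 -> Prop).
Hypotheses (P1 : P 1%:M) (PM : forall A B, P A -> P B -> P (A *m B)).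
Hypothesis PT : forall i j, i != j -> P (transv i j).

Lemma transvK m (i j : 'I_m) (A : 'M['F_2]_m) : i != j ->
  transv i j *m (transv i j *m A) = A.
Proof.
move=> ij; apply/matrixP => k l; rewrite !mul_transv (negPf ij) addr0.
by case: eqP => _; rewrite ?addr0 // -addrA; case: (F2_cases (A i l)) => ->;
  rewrite ?addr0 //; case: (F2_cases (A k l)) => ->; apply/val_inj.
Qed.

Lemma tperm_gen i j : P (tperm_mx i j).
Proof.
have [->|ij] := eqVneq i j; first by rewrite /tperm_mx tperm1 perm_mx1.
have ji : j != i by rewrite eq_sym.
(* Two rows are swapped by three row additions, as in the exclusive-or swap. *)
suff -> : tperm_mx i j = transv i j *m (transv j i *m (transv i j *m 1%:M)) :> 'M['F_2]_n.+1.
  by do 2![apply: PM; first exact: PT]; apply: PM => //; exact: PT.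
apply/matrixP => k l; rewrite !mul_transv !mxE permE /=.
rewrite ?eqxx ?(negPf ij) ?(negPf ji) ?addr0.
have [->|ki] := eqVneq k i; rewrite ?eqxx ?(negPf ij) ?(negPf ji) ?addr0.
  by case: (i == l); case: (j == l); apply/val_inj.
have [->|kj] := eqVneq k j; rewrite ?eqxx ?(negPf ij) ?(negPf ji) ?addr0 //.
by case: (i == l); case: (j == l); apply/val_inj.
Qed.

Lemma perm_gen s : P (perm_mx s).
Proof.
have [ts -> _] := prod_tpermP s.
elim: ts => [|t ts IH]; first by rewrite big_nil perm_mx1.
by rewrite big_cons perm_mxM; apply: PM => //; exact: tperm_gen.
Qed.

(** Induction on the number of nonzero entries off the diagonal: row operations clear them one by
    one, starting from the top row that has any. *)
Lemma unitriangular_gen (L : 'M['F_2]_n.+1) :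
  (forall i j : 'I_n.+1, (i <= j)%N -> L i j = (i == j)%:R) -> P L.
Proof.
have [m] := ubnP #|[set p : 'I_n.+1 * 'I_n.+1 | (p.1 != p.2) && (L p.1 p.2 != 0)]|.
elim: m L => // m IH L; rewrite ltnS => lem Ltri.
have [/pred0P none|/pred0Pn[i0 /existsP i0P]] :=
    boolP (pred0b [pred i | [exists j, (i != j) && (L i j != 0)]]).
  suff -> : L = 1%:M by [].
  apply/matrixP => i j; rewrite mxE; have [->|ij] := eqVneq i j.
    by rewrite Ltri // eqxx.
  have /negbT := none i; rewrite negb_exists => /forallP/(_ j).
  by rewrite ij negbK => /eqP.
pose Q i := [exists j, (i != j) && (L i j != 0)].
have Qi0 : Q i0 by apply/existsP.
case: (@arg_minnP _ i0 Q (fun i => i : nat) Qi0) => i /existsP[j /andP[ij Lij]] mini.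
have ltji : (j < i)%N.
  by rewrite ltnNge; apply: contra Lij => leij; rewrite Ltri // (negPf ij).
(* Row j lies above i, so by minimality of i it is a unit row; adding it to row i changes the entry
   (i, j) alone. *)
have rowj l : L j l = (j == l)%:R.
  have [<-|jl] := eqVneq j l; first by rewrite Ltri ?eqxx.
  apply/eqP; apply: contraTT ltji => Ljl; rewrite -leqNgt; apply: mini.
  by apply/existsP; exists l; rewrite jl.
have ji : j != i by rewrite eq_sym.
suff PL : P (transv j i *m L).
  by have := PM (PT ji) PL; rewrite transvK.
have L'E k l : (transv j i *m L) k l = if (k == i) && (l == j) then 0 else L k l.
  rewrite mul_transv rowj; case: eqP => [->|_] /=; last by rewrite addr0.
  rewrite [j == l]eq_sym; case: eqP => [->|_]; last by rewrite addr0.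
  by case: (F2_cases (L i j)) Lij => -> //; rewrite ?eqxx // => _; apply/val_inj.
apply: IH => [|k l lekl].
  apply: leq_trans lem; apply: proper_card; apply/properP; split.
    apply/subsetP => -[k l]; rewrite !inE /= L'E => /andP[-> /=].
    by case: ifP; rewrite ?eqxx.
  by exists (i, j); rewrite !inE /= ?L'E ?ij ?Lij // !eqxx.
rewrite L'E Ltri //; case: andP => // -[/eqP ki /eqP lj].
by move: lekl; rewrite ki lj leqNgt ltji.
Qed.

End TransvectionsGenerate.

(** The LUP decomposition writes A as a permutation matrix times a lower and an upper unitriangular
    one. *)
Lemma transv_gen n (P : 'M['F_2]_n.+1 -> Prop) :
  P 1%:M -> (forall A B, P A -> P B -> P (A *m B)) ->
  (forall i j, i != j -> P (transv i j)) ->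
  forall A, A \in unitmx -> P A.
Proof.
move=> P1 PM PT A uA.
have := cormen_lup_correct A; have := cormen_lup_perm A.
have := @cormen_lup_lower _ _ A; have := @cormen_lup_upper _ _ A.
case: (cormen_lup A) => [[S L] U] /= Uup Llow /is_perm_mxP[s ->].
rewrite -!mulmxE => E.
have uLU : L *m U \in unitmx by rewrite -E unitmx_mul unitmx_perm.
have uU : U \in unitmx by move: uLU; rewrite unitmx_mul => /andP[].
have -> : A = perm_mx s^-1 *m (L *m U).
  by rewrite -E mulmxA -perm_mxM mulVg perm_mx1 mul1mx.
apply: (PM); first exact: (perm_gen P1 PM PT).
apply: (PM); first exact: (unitriangular_gen P1 PM PT).
(* The upper factor is treated as the transpose of a lower one: transposition preserves the set of
   transvections and reverses products. *)
rewrite -[U]trmxK; apply: (@unitriangular_gen n (fun B => P B^T)).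
- by rewrite trmx1.
- by move=> B C PB PC; rewrite trmx_mul; exact: PM.
- move=> i j ij; have -> : (transv i j)^T = transv j i by rewrite linearD /= trmx1 trmx_delta.
  by apply: PT; rewrite eq_sym.
move=> i j; rewrite leq_eqVlt mxE => /orP[/eqP/val_inj->|ltij]; last first.
  by rewrite Uup // -val_eqE ltn_eqF.
(* A diagonal entry of U is 0 or 1, and a 0 would make the determinant vanish. *)
rewrite eqxx; have [U0|//] := F2_cases (U j j).
have trU : is_trig_mx U^T by apply/is_trig_mxP => k l ltkl; rewrite mxE Uup.
move: uU; rewrite unitmxE -det_tr (det_trig trU) unitfE.
by rewrite (bigD1 j) //= mxE U0 mul0r eqxx.
Qed.

(** * Invariant classes *)

Lemma wle_total w w' : wle w w' || wle w' w.
Proof.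
elim: w w' => [|a v IH] [|b v'] //=; first by rewrite orbT.
by have [||] := ltngtP a b; rewrite ?orbT //= => _; exact: IH.
Qed.

Lemma Pwlt_Pwle m w f : f \in Pwlt_pred m w -> f \in Pwle_pred m w.
Proof.
apply: sub_all => u /andP[-> wu] /=.
by have := wle_total (weight u) w; rewrite orbC (negPf wu).
Qed.

Lemma Qnull_hit_lt w (F : Pwle 5 w) : F \in Qnull 5 w <-> hit_lt w (val F).
Proof.
split=> [/asboolP[H [K [hH _ lK E]]]|[H [K [hH lK E]]]]; first by exists H, K.
apply/asboolP; exists H, K; split=> //.
have -> : H = val F - K by rewrite E addrK.
by apply: rpredB; [exact: valP|exact: Pwlt_Pwle].
Qed.

Lemma Qw_class_eqP w (F F' : Pwle 5 w) :
  Qw_class F = Qw_class F' <-> hit_lt w (val F - val F').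
Proof. by rewrite Qw_class_eq; exact: Qnull_hit_lt. Qed.

Lemma Qw_inv_hit_lt w (F : Pwle 5 w) : Qw_class F \in Qw_inv 5 w ->
  forall g, g \in unitmx -> hit_lt w (gl_act g (val F) - val F).
Proof.
move=> /asboolP invF g ug; apply/(Qw_class_eqP (Pwle_act g F)).
by rewrite -Qw_act_class invF.
Qed.

Lemma certified_no_invariants w d : wdeg w = 18%N -> data_certificate w 0 d ->
  forall c : Qw 5 w, c \in Qw_inv 5 w <-> c = 0.
Proof.
move=> w18 cert c; split=> [|->]; last exact: rpred0.
have [F ->] := Qw_class_surj c => invF.
have [a ha] := certificateP w18 cert (valP F) (Qw_inv_hit_lt invF).
(* With [free] equal to 0 the combination of orbit sums is empty. *)
rewrite big_ord0 in ha; rewrite -(raddf0 (@Qw_class 5 w)).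
exact/Qw_class_eqP.
Qed.

(** * Data *)

(** The first functional is the coefficient of the spike x1^15 x2^3. *)
Definition data1 : cert_data := CertData
"0003f 0007b 000f3 0012f 0013e 0016b 0017a 001e3 001f2 0030f 0031e 0033c 0035a
003d2 0070b 0071a 00f03 00f12 0102f 0103e 0106b 0107a 010e3 010f2 0112e 0116a
011e2 0120f 0121e 0123c 0124b 0125a 01278 012c3 012d2 0130e 0132c 0134a 01368
013c2 0160b 0161a 01728 01e03 01e12 0305a 030d2 0312c 0314a 03168 031c2 03348
03528 03582 07128 1122c 1124a 11268 11628 12348"%string
[:: "f3000"%string;
"0112e 0121e 0212d 0221d 0341a 03429 03816 03825 0412b 0421b 0521a 05229 05823
0611a 06129 06813 08127 08217 09216 09225 09423 0a116 0a125 0a413 0c123 0c213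
03546 03645 05346 05427 05526 05616 05643 06345 06417 06525 06543 06615 07416
07425 0322b 0332a 0a323 0b223 03636 03726 06327 06336 06633 06723 07227 07326
0511b 05319 09117 09315 0d113 03555 05355 05553 05715 0331b 03393 03b13 0b313
05373"%string]
"11226 11426 03324 05318 06314 09314 03314 03614 03914 03126 05126 07126 07145
01326 01526 01726 01745 0151a 0131a 0231a 04316 08315 04325 02516 01916 01716
02716 04715 02725 01925 01625 01619 02519 02325 02345 01345 01366 01515 02714
01714 01236 01439 02435 01835 00336 00536 00935 00635 00335 00365 00355 12344
11384 13442 11624 11264 11246 07124 0b114 07214 03542 03941 03641 03922 05522
09322 09341 06341 03381 03382 03164 03162 05162 03194 03254 03146 03185 03145
03166 03056 03095 03065 01607 01907 02507 01307 02307 04307 01364 01362 01562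
01394 02354 01274 011b4 01174 011b2 02172 031b2 04172 08171 04271 032b1 012b2
014b1 022b1 012b1 011d1 02471 01871 013b2 023b1 012b3 021b3 01256 01276 01376
02375 01247 01187 01147 01166 01196 02176 04175 02275 02195 02163 031a3 03293
02253 02473 01493 01463 01453 02433 04433 013a3 01293 01265 01255 02235 04235
08233 04153 08133 04135 0313a 01167 02135 01136 02167 04137 03257 04237 01076
010b5 010b3 02073 04073 07073 01075 01067 01077 02057 01037 0203b 03704 02077
00716 00b15 00725 00707 00176 001b5 00275 00173 00273 00473 00167 00197 00257
0013b 00237 0033b 00347 00367 00537 00637 00277 00377 00376 00575 00673 00653
00953 00553 00363 00373 00372 00572 00971 00671 00371 00a33 00077 33434 0311c
030d1 01d03 0111e 0110f 010f1 0101f 00f11 0031d 00327 00317 00617 00717 00727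
00737 00734 00b33 00743 00773 00772 00771 00761 00751 00b32 00d31 00b23 00b13
001f1 0011f 0112d0111d 0211d 0111d 01227 0121b 02217 0411b 04127 07127 07217
0312b 02417 01417 01627 01347 02527 04327 04337 02338 02534 01934 01634 01636
01356 02536 04535 04633 02653 02633 01a33 01643 01383 01543 02743 04733 02734
02753 01763 01762 01781 02741 01b41 01b22 01b12 02712 04712 08711 04721 02b21
01721 01d11 04723 03923 03a13 04613 04313 04323 08333 04343 04373 03374 03274
05174 06172 03172 03252 03472 05471 06371 06271 06191 03191 032a1 03461 03451
03661 05261 09161 06251 0a151 05131 03473 03243 03183 06163 03163 05263 05453
06433 06235 06135 05155 03256 03253 03435 03436 03234 03136 06134 09134 09232
09431 06231 0a131 06431 05431 03832 03833 03743 03742 03741 06721 06521 09521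
05621 03621 03c11 03a12 05612 09512 09311 05611 03911 06312 0c311 03437 03247
03237 06137 06127 03125 03229 03427 05417 03417 03216 03217 06119 06116 05116
07216 07415 07225 09215 09113 03416 03716 03725 03823 03813 06413 0a313 09323
09223 07143 0a123 06113 0b213 07223 07433 07334 07342 07521 07621 07611 07412
0b411 0b212 07432 07251 07261 07241 0b231 0b132 0b122 0d112 07141 0b221 0b121
0d111 02374 02373 01673 01672 01592 02392 02372 04571 03671 03372 033a1 04361
04351 08332 08331 06631 03651 03652 03554 03364 05362 03552 05352 06334 05334
03632 03932 04732 04751 02761 02561 015a1 01671 02651 02951 02931 02631 02731
01b32 01632 01651 02a13 02b13 01b23 1112c1114a112a21212a 11a14 14216 11618
1152811518 15182 11324 12324 12318 18223 13184 13244 13144 14243 13283 18323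
12524 12514 11914 1121c1141a1221a121a2 12164 11168 11164 11622 1125811158
11382 11258 12254 11254 12922 14522 14322 11834 12434 12338 13382 12238 12138
13424 13224 15224 19222 13328 18233 143541453412364126342433412554
135441435412364136422235411564 11662 11462 11292 12252 12152 14162 15218 11825
12813 11416 12415 11225 11125 1212a 1112a 111a2 1121a 11146 12185 12243 11483
11283 14432 11843 03077050570507505093053090306703076037060607303506050630330a
0330b 03407 03707 02707 01709 01706 01b03 02703 0303b 0303a 03035 03506 0330a
05306 05093 05053 03305 030a3 030b3 030b2 03071 06071 07109 07072 07091 06107
0510b 03207 03107 03074 03077"%string
"0 1 101 102 103 104 010 112 113 114 020 021 121 123 124 030 031 131 134 040
041 141 142 143 00120 10123 10124 00130 10131 10132 10134 10231 10234 10324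
10421 10423 10424 10431 10434 01030 01031 01040 01041 11231 02040 02041 12102
02140 12402 13103 13203 13403 00140 10412 01020 02030 03040 03110 0214030
0401020 0301220 0301440"%string
"9e4eef9050984 8a4eef9050984 5a6e4ebaf51863 200002 6c4f6f8ad0b845 24c18010002
4a2e4fbaf51867 20a08 8e4eee9050984 30791a9 043a99a0a5e027 e241801a802005
20020020a58022 e000202aa58022 20b8188 243b99a0a5e027 30a 202 200004
aa8e69f44302d 24101c8008 ae9661744302d02 080834000880002 20790a9
24624e5045000682 410d6ae065a006a 0304200001002 200008 6f0800a40300f682
bacee9f44303d 18c3929000300032 02000020258022 9aafebe44323d4a 3ca8b4000090001
60680ad041 28792e900880002 9e5fbb04abe0fd83 8102000000004 60002001
6f37c84540984 2ccb1a900810002 af0e22a406009682 105399a0ade02b01 2cb23400009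
2c59a6900098 2002 201 5ee01b20cbea05d3 4000002 c00142000004 e10142000004
265b6af0ceb8d783 a31148005 e3114822f58022 3df11b008bea05d3 c3682ad040003
426c0ad04 c96e6ef442004 617d00f2b48032 027962f2b58012"%string.

(** Spikes have non-increasing weight vectors, so [omega_bar 2], like [omega_bar 3] and
    [omega_bar 5], has none; the functional is a sum of several coefficients. *)
Definition data2 : cert_data := CertData
"12447 12456 12546"%string
[:: "17244 17424 17442 27144 27414 27441 47124 47142 47214 47241 47412 47421 1b222
2b122 2b212 2b221 17226 17262 17622 27126 27162 27216 27225 27234 27243 27252
27261 27324 27342 27423 27432 27522 27612 27621 37224 37242 37422 47223 47232
47322 57222 67122 67212 67221 17118 17181 17811 1b114 1b141 1b411 4b111 87111
17145 17154 17415 17451 17514 17541 47115 47151 47511 57114 57141 57411 1b123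
1b132 1b213 1b231 1b312 1b321 2b113 2b131 2b311 3b112 3b121 3b211 17235 17523
17532 27117 27153 27171 27315 27351 27711 37215 37251 37512 57123 57132 57321
77211"%string]
"11427 12472 11474 14722 12714 14227 14417 17224 14172 12272 1122b 1221b 11b22
12722 11744 16162 12616 12526 14316 16225 15164 15262 11526 13462 13262 1132a
12316 16223 15443 12326 14345 24325 15243 15226 13416 16234 16432 15452 15252
13254 13434 23434 24343 22323 13445 13346 13226 13216 11a23 12613 14523 12543
25433 12436 14435 14236 12236 1123a 12392 12166 14156 15622 13642 13544 23543
23524 14235 14165 16522 15542 22255 12255 12463 14453 24433 23344 23343 26333
16334 16322 11a32 12932 22253 14534 12634 12554 11564 12562 11436 11465 14362
12352 07621 07521 07342 07334 07432 07251 07231 07232 07132 07433 07423 07325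
07316 07213 07223 07235 07136 07324 07322 07312 07613 07323 07072 06721 03741
03742 03743 02743 01725 01723 02723 03725 03716 04733 04732 04751 02731 02732
01752 03724 03722 03712 06713 03723 06631 06613 06361 06551 06532 06334 05354
05362 05352 03651 03361 03362 03552 03334 06316 06313 06523 06323 05345 05343
03643 03343 03526 03523 05615 06307 03307 06271 05471 03472 03374 04372 04371
02371 02372 01572 04373 02473 01473 01273 02273 04175 03176 03274 05174 06173
03273 06217 05417 03427 03347 04327 03527 03617 02317 02327 02537 01637 04337
04237 04137 02137 02237 01237 03247 05127 06163 06136 06135 06235 06335 05336
03436 03435 03265 03255 03156 05263 03253 06073 05073 03706 03705 02707 02077
01663 01636 01655 02653 04553 02563 02365 04355 02355 01555 02536 03536 03635
00772 00763 00733 00727 00673 00575 00637 00537 00277"%string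
"0 001 031 00121"%string
"c f 9"%string.

Definition data3 : cert_data := CertData
"12366 13266"%string
[:: "35622 36522 36612 36621 53622 56322 63522 63612 63621 65322 66312 66321 35541
53541 55341 55512 55611 56511 65511 33381 33912 33a11 39312 3a311 93312 a3311
36531 53361 53712 56331 57312 63351 63531 63711 67311 75312 76311 33372"%string]
"25433 25343 26333 24533 24353 24333 23543 23343 23336 23433 23363 23334 17432
22733 17423 23273 17243 23327 14732 22373 22273 12275 11276 11762 14723 23237
22723 15227 16217 11726 14372 22337 22327 12527 12617 16172 22237 12237 12167
11672 13265 16523 15623 23236 23235 23326 23253 15263 16163 13326 13616 12365
13652 13562 22336 22335 16352 11636 22633 22553 12563 11663 07721 07631 07332
07613 07323 07271 07253 07233 07217 06731 03732 06713 03723 06533 06371 03372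
06353 06333 06317 03327 06173 03273 06137 03237 03653 03633 03336 02771 02753
02733 02717 02573 02373 02537 02337 02177"%string
"0 030 031"%string
"3 5"%string.

(** The first generator, x1 x2 x3 x4 x5^14, gives the surviving orbit. Its coefficient stays free,
    so row 0 of the matrix is a placeholder. *)
Definition data4 : cert_data := CertData
"1111e 0113d 011f1 0131d 01359 013d1 01f11 0311d 03159 031d1 03519 03591 03d11
0f111 0111f 1112d 1113c 1121d 11259 11349 11358 12519"%string
[:: "f1110"%string]
"12315 14315 13143 13145 12913 11334 11534 11932 11552 11572 11374 11325 11525
11523 11543 11343 11235 11435 11433 11453 11293 11217 11417 11617 11615 11613
11136 11156 11176 11174 11172 1111b 11b12 11714 11716 11913 15152 11515 11316
15172 13174 13154 13156 13615 13415 11127 11147 11167 11157 12157 13714 13514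
13314 14153 12193 11175 11163 03711 05711 07711 07511 0b311 03351 05351 05331
05531 03931 03315 05315 09313 05513 05713 03715 03171 05171 07171 07151 07131
03135 05135 05133 05153 03153 03117 05117 07117 07115 0b113 01371 01571 01771
01751 01731 01335 01535 01533 01553 01353 01317 01517 01717 01715 01b13 01137
01157 01177 01175 011b3"%string
"0 010 020 030 040 041 042 043 00140 00240 00340 01020 02030 03040 03041 03043
01030 01040 02040 04220 0403020 0024010"%string
"0 071 14 8a04 9e3422 0d2 18 82 d711 44 3a041 7da 28 314 12 8224c 8124c 8c08
cd4d43 4121a3 421763 4f0c4"%string.

Definition data5 : cert_data := CertData
"03555 12555 13455"%string
[:: "35055 53055 55035 55053 33039 33093 39033 93033 53037 53073 57033 75033"%string]
"15316 15217 13217 15172 13172 15163 13163 14317 12317 11317 11327 14173 12173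
13714 12137 13615 13136 13453 15253 13253 13193 13153 13525 13345 15323 13523
13139 13235 13147 12713 11713 11723 12553 14533 12333 11752 11732 11173 11273
11653 11572 11372 1113b 11237 11563 11536 11555 15352 15334 13332 07531 07513
07153 05731 05713 05371 05317 05173 05137 03553 05533 05335 01753 01573 01537"%string
"0 020 021 02021"%string
"a f 9"%string.

Definition data6 : cert_data := CertData
"01377 01737 01773 03177 03357 03375 03537 03573 03717 03735 03753 03771 07137
07173 07317 07335 07353 07371 07713 07731 11277 11367 11376 11637 11673 11727
11736 11763 11772 12357 12375 12537 12573 12717 12735 12753 13167 13176 13257
13275 13347 13356 13365 13437 13473 13527 13536 13563 13617 13635 13653 13716
16173 16317 16335 16353"%string
[:: "77310"%string]
"16333 13633 15533 13363 15353 13336 15335 25333 13327 15317 13317 17233 13273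
15173 13173 17323 13237 13715 13137 13723 12733 12373 12337 07333 03733 03373
03337 13553 13533 13335 23335 23353 33334 11753 11733 17332 11717 11573 11373
13732 11537 11337 13372 11177"%string
"0 020 021 030 031 032 040 041 042 043 03031 03032 03132 04041 04042 04043
04142 04143 02040 02041 02042 02043 02140 02141 02142 02143 02031 02130 02131
02132 03040 03041 03042 03043 03140 03141 03142 03143 03240 03241 00330 04220
01331 04330 04331 0424041 0434120 0101441 0412140 0402142 0303143 0414030
0424030 0434031 0313440 0304142 0413240"%string
"302002 5020002 102 940802c1 2b21a2000004 e020028 914 45280001 928 c020002
0a202 3 50200020005 51000001 1301 41200020005 03000003 5 12 40200020001 26004
f020fbd298ee61 458be7a04eec65 e653ac42b99c11 4b8bb5a04eec65 524757b021727
0d8bb5876ebc65 119da5876ebe65 063042 6d992fc5557664 c3e84bc2f75074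
75600284400004 e3d85ac2ff5074 5a675f9021227 86200027005 4f2020200451
d2b587666aef65 b619f355b16e61 fa77f5b031767 a9100aa0015 9589a5a27cee64
406afd5014cbfa1 5575b3bf7f69a41 cd3e7571b3737 c509002720d a46807a2fcea64
5d6e4d063171781 a1ae9d573cf4661 923da5876cbe65 99e32c4143bdc2 b3388ae82d99821
988ddfb74aef65 6a5bef45916c11 6130f1b4b17661 936d654750ccfa1 d9bd155e1175e4"%string.

(** The monomials whose squares into degree 18 add up, modulo smaller weights, to [Re4] plus the
    orbit sum of x1 x2 x3 x4 x5^14. *)
Definition Re4_orbit_hits : string :=
"13116 131a1 13a11 15116 15161 15611 17111 17114 17116 17121 17141 17161 17411
17611 1b112 1b211 27111 31116 311a1 31611 35112 35114 35141 35211 35411 39111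
39121 47111 51116 51161 51611 56111 67111 71114 71116 71121 71141 71161 71411
71611 72111 74111 76111 b1111 b1112 b1211"%string.

(* Each token is a pair (i, j) followed by exponent vectors. *)
Definition Re4_transvection_hits : string :=
"0113116131a113a11151161516115611171161716117611
020371111316113a11151611561117141171611721117411176111b1111b1212711133141351113512135141471115341155211671119321
030317111136111561117411176111b1111b21127111471116311165111671121b1131511325113431134511417115134151521617119132
04031171111b1112b111471116311165111671121b1141711613116151161712117131151312513145131831411715213152151541316117
103111a3116131611511165116151611711167116171611
1211316113611151611561117121171411716117411176111b2111d1121711315143154131911319123192131a11325114171161711
131113a11156111721117411176111b11127111471116511167111a31211b1311523115431161312913145132191411715119161171
141111b1112b11147111631116511167112171141711613116151161721117311153111a31129311453121531415321194111761117
2031a11534117141171611b1211b3011 2113a1117211174111761135411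
23112b11167111a311345131451 24112171161711a131341531415
30311a15314171121711417116173101 311316117121171411716135141
32113611176111b211354131541 341112b11163111671314531145
40311165311471112711147111673110 411311617114171161b11235114
421131611712117161351431514 431113611172111761315431154"%string.

(** * Verification of the certificates *)

Lemma certified1 : data_certificate (omega_bar 1) 0 data1.
Proof. by vm_compute. Qed.
Lemma certified2 : data_certificate (omega_bar 2) 0 data2.
Proof. by vm_compute. Qed.
Lemma certified3 : data_certificate (omega_bar 3) 0 data3.
Proof. by vm_compute. Qed.
Lemma certified4 : data_certificate (omega_bar 4) 1 data4.
Proof. by vm_compute. Qed.
Lemma certified5 : data_certificate (omega_bar 5) 0 data5.
Proof. by vm_compute. Qed.
Lemma certified6 : data_certificate (omega_bar 6) 0 data6.
Proof. by vm_compute. Qed.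

(** * The class of [Re4] *)

Definition Re4_exps : seq (seq nat) :=
  [:: [:: 1; 1; 1; 1; 14]; [:: 1; 1; 1; 14; 1]; [:: 1; 1; 14; 1; 1];
      [:: 1; 3; 1; 1; 12]; [:: 1; 3; 1; 12; 1]; [:: 1; 3; 12; 1; 1];
      [:: 3; 1; 1; 1; 12]; [:: 3; 1; 1; 12; 1]; [:: 3; 1; 12; 1; 1];
      [:: 3; 5; 1; 1; 8]; [:: 3; 5; 1; 8; 1]; [:: 3; 5; 8; 1; 1]]%N.

Lemma mon5E a b c d e : mon5 a b c d e = mon [:: a; b; c; d; e].
Proof. by congr 'X_[_]; apply/mnmP => i; rewrite multinomE mnmE (tnth_nth 0%N). Qed.

Lemma Re4E : Re4 = ev Re4_exps.
Proof. by rewrite /ev !big_cons big_nil addr0 !addrA /Re4 !mon5E. Qed.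

Definition orbit4 : seq nat := nth [::] (tokens (cert_gens data4)) 0.

Lemma Re4_orbit : hit_lt (omega_bar 4) (Re4 + ev (rots orbit4)).
Proof.
rewrite Re4E -ev_cat; apply: (@hit_certP _ _ _ (tokens Re4_orbit_hits)).
  exact: omega_bar_deg.
by vm_compute.
Qed.

Definition Re4_transvections : bool :=
  let hits := tokens Re4_transvection_hits in
  all (fun i => all (fun j => (i == j) ||
      has (fun s => (take 2 s == [:: i; j]) &&
        hit_cert (omega_bar 4) (flatten (map (transv_exps i j) Re4_exps) ++ Re4_exps)
          (fives (drop 2 s))) hits)
    (iota 0 5)) (iota 0 5).

Lemma Re4_transvectionsP : Re4_transvections.
Proof. by vm_compute. Qed.

Lemma Re4_transv (i j : 'I_5) : i != j ->
  hit_lt (omega_bar 4) (gl_act (transv i j) Re4 - Re4).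
Proof.
move=> ij; have -> : gl_act (transv i j) Re4 - Re4 =
    ev (flatten (map (transv_exps i j) Re4_exps) ++ Re4_exps).
  rewrite oppF2 Re4E ev_cat ev_flatten big_map raddf_sum; congr (_ + _).
  by apply: eq_bigr => u _; exact: transv_mon.
have /allP/(_ (i : nat)) := Re4_transvectionsP; rewrite mem_iota ltn_ord => /(_ isT).
move=> /allP/(_ (j : nat)); rewrite mem_iota ltn_ord => /(_ isT).
case/orP=> [/eqP/val_inj eij|/hasP[s _ /andP[_ cert]]].
  by rewrite eij eqxx in ij.
exact: (hit_certP (omega_bar_deg (isT : 0 < 4 <= 6)%N) cert).
Qed.

(** Serves to replace the orbit sum v by the congruent representative u = [Re4]. *)
Lemma subZF2 (V : lmodType 'F_2) (x v u : V) (a : 'F_2) :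
  x - a *: u = x - a *: v + a *: (u + v).
Proof. by rewrite scalerDr !oppF2 [_ *: u + _]addrC addrA -[x + _ + _]addrA addF2 addr0. Qed.

(** The matrices fixing the class are closed under products, so the transvections suffice. *)
Lemma Re4_invariant :
  Qw_class (exist _ Re4 Re4_Pwle) \in Qw_inv 5 (omega_bar 4).
Proof.
apply/asboolP; apply: transv_gen => [|A B EA EB|i j ij].
- exact: Qw_act1.
- by rewrite Qw_actM EB.
by rewrite Qw_act_class; apply/Qw_class_eqP; exact: Re4_transv.
Qed.

Theorem theorem2p8 :
  (forall k : nat, k \in [:: 1; 2; 3; 5; 6]%N ->
     forall c : Qw 5 (omega_bar k), c \in Qw_inv 5 (omega_bar k) <-> c = 0)
  /\
  (forall c : Qw 5 (omega_bar 4),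
     c \in Qw_inv 5 (omega_bar 4) <->
     exists a : 'F_2, c = a *: Qw_class (exist _ Re4 Re4_Pwle)).
Proof.
split=> [k|c].
  rewrite !inE => /or4P[/eqP->|/eqP->|/eqP->|/orP[]/eqP->].
  - exact: certified_no_invariants (omega_bar_deg _) certified1.
  - exact: certified_no_invariants (omega_bar_deg _) certified2.
  - exact: certified_no_invariants (omega_bar_deg _) certified3.
  - exact: certified_no_invariants (omega_bar_deg _) certified5.
  - exact: certified_no_invariants (omega_bar_deg _) certified6.
split=> [|[a ->]]; last by apply: rpredZ; exact: Re4_invariant.
have [F ->] := Qw_class_surj c => invF.
have w18 : wdeg (omega_bar 4) = 18%N by exact: omega_bar_deg.
have [a ha] := certificateP w18 certified4 (valP F) (Qw_inv_hit_lt invF).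
(* With [free] equal to 1 only the orbit of [orbit4] is left. *)
rewrite big_ord1 in ha.
exists (a 0%N); rewrite -linearZ; apply/Qw_class_eqP.
suff: hit_lt (omega_bar 4) (val F - a 0%N *: Re4) by [].
rewrite (subZF2 _ (ev (rots orbit4))).
apply: hit_ltD; first exact: ha.
by apply: hit_ltZ; exact: Re4_orbit.
Qed.
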